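(* Let $\phi,\psi:[0,1]\to\mathbb{R}$ be continuous on $[0,1]$ and twice continuously differentiable on $(0,1]$, with $\phi$ concave, $\phi(0)=\phi(1)=0$, $-1<\phi'(1)<0$, and $\psi$ convex, $\psi(1)=0$, $\psi'(1)<0$, $\psi''(1)-\phi''(1)>0$. Let $w(x,t)$, $0\le x<1$, $t\ge 0$, with associated function $\kappa(\cdot)$, be the solution of $$\frac{\partial w}{\partial t}+[\phi(x)-\kappa(t)\psi(x)]\frac{\partial w}{\partial x}=w,\qquad \int_0^1 w(x,t)\,dx=1,$$ with initial data $w(\cdot,0)=w_0$, and assume that the beta function $\beta(\cdot,0)$ of the initial data satisfies $\lim_{x\to 1}\beta(x,0)=\beta_0$ with $0<\beta_0<1$. Then there is a constant $C_1>0$, depending only on the initial data, such that $\kappa(t)\ge C_1$ for all $t\ge 0$. If in addition $\phi,\psi$ are $C^3$ on $(0,1]$ with $\phi'''(x)\ge 0$ and $\psi'''(x)\le 0$ for $0<x\le 1$, then there is a constant $C_2>0$, depending only on the initial data, such that $\kappa(t)\le C_2$ for all $t\ge 0$, and $$\lim_{T\to\infty}\frac1T\int_0^T\kappa(t)\,dt=\frac{1/\beta_0-\phi'(1)-1}{|\psi'(1)|}.$$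
   Context: Initial data: $w_0(x)=\int_x^1 c_0(x')\,dx'$, $0\le x<1$, where $c_0\ge 0$ is an integrable function on $[0,1)$, $w_0(x)>0$ for all $0\le x<1$ (so $w_0$ is non-increasing and $w_0(x)\to 0$ as $x\to 1$), and $\int_0^1 w_0(x)\,dx=1$. Solution: $\kappa:[0,\infty)\to(0,\infty)$ is the continuous function uniquely determined by the requirement that the solution $w$ of the PDE satisfies the conservation law $\int_0^1 w(x,t)\,dx=1$ for all $t\ge0$. The solution is given by characteristics: $w(x,t)=e^t w_0(F(x,t))$, where $F(x,t)=x(0)$ and $x(s)$, $0\le s\le t$, solves $\frac{dx(s)}{ds}=\phi(x(s))-\kappa(s)\psi(x(s))$, $x(t)=x$. Beta function: $c(x,t)=-\partial w(x,t)/\partial x$ (so $c(\cdot,0)=c_0$ and $c(x,t)=e^tc_0(F(x,t))\,\partial F(x,t)/\partial x$), $h(x,t)=\int_x^1 w(x',t)\,dx'$, and $\beta(x,t)=c(x,t)h(x,t)/w(x,t)^2$, $0\le x<1$. ''Depending only on the initial data'' means: for the given coefficients $\phi,\psi$, the constant is determined by $w_0$ and does not depend on $t$. *)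

(* Defs.v *)
From HB Require Import structures.
From mathcomp Require Export all_boot all_order all_algebra.
From mathcomp Require Export all_classical all_reals all_analysis.
Export Order.TTheory GRing.Theory Num.Theory.
Export numFieldNormedType.Exports.

Set Implicit Arguments.
Unset Strict Implicit.
Unset Printing Implicit Defensive.

Local Open Scope classical_set_scope.
Local Open Scope ring_scope.

(* Functions on an interval such as [0, 1] are represented by total functions
   R -> R of which only the values on the interval are ever used. *)

(* Derivative relative to a set A: the limit of difference quotients is taken
   through points of A only.  At an interior point of A this is the usual
   derivative; at the right endpoint of ]0, 1] it is the left derivative. *)
Definition diff_quot (R : realType) (f : R -> R) (x y : R) : R :=
  (f y - f x) / (y - x).

Definition derivable_in (R : realType) (A : set R) (f : R -> R) (x : R) : Prop :=
  cvg (diff_quot f x y @[y --> within A x^']).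

Definition deriv_in (R : realType) (A : set R) (f : R -> R) (x : R) : R :=
  lim (diff_quot f x y @[y --> within A x^']).

Fixpoint C_in (R : realType) (k : nat) (A : set R) (f : R -> R) : Prop :=
  if k is k'.+1 then
    (forall x, A x -> derivable_in A f x) /\ C_in k' A (deriv_in A f)
  else {within A, continuous f}.

Definition deriv_n (R : realType) (n : nat) (f : R -> R) : R -> R :=
  iter n (deriv_in `]0, 1]%classic) f.

(* int_x^1 f; it gives w_0 from c_0 and h(., t) from w(., t). *)
Definition tail_integral (R : realType) (f : R -> R) (x : R) : R :=
  \int[lebesgue_measure]_(y in `[x, 1%R[) f y.

(* The beta function c h / w^2 of a profile w with density c = - w'. *)
Definition beta (R : realType) (c w : R -> R) (x : R) : R :=
  c x * tail_integral w x / w x ^+ 2.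

Definition coefficients (R : realType) (phi psi : R -> R) : Prop :=
  [/\ {within `[0, 1]%classic, continuous phi},
      {within `[0, 1]%classic, continuous psi},
      C_in 2 `]0, 1]%classic phi & C_in 2 `]0, 1]%classic psi] /\
  [/\ convex_function (`[0, 1]%classic : set R^o) (fun x => - phi x : R^o),
      phi 0 = 0, phi 1 = 0 & -1 < deriv_n 1 phi 1 < 0] /\
  [/\ convex_function (`[0, 1]%classic : set R^o) (psi : R^o -> R^o),
      psi 1 = 0, deriv_n 1 psi 1 < 0 & 0 < deriv_n 2 psi 1 - deriv_n 2 phi 1].

Definition initial_density (R : realType) (c0 : R -> R) : Prop :=
  [/\ forall x, 0 <= x < 1 -> 0 <= c0 x,
      lebesgue_measure.-integrable `[0%R, 1%R[ (EFin \o c0),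
      forall x, 0 <= x < 1 -> 0 < tail_integral c0 x
    & tail_integral (tail_integral c0) 0 = 1].

(* X is a solution on [0, t], with values in [0, 1], of
   dX/ds = phi(X) - kappa(s) psi(X) with terminal condition X(t) = x.
   With X continuous on [0, t] and the right-hand side continuous, the equation
   on the open interval gives the one-sided derivatives at 0 and t. *)
Definition characteristic (R : realType) (phi psi kappa : R -> R) (x t : R)
    (X : R -> R) : Prop :=
  [/\ forall s, 0 <= s <= t -> 0 <= X s <= 1,
      {within `[0, t]%classic, continuous X},
      forall s, 0 < s < t ->
        is_derive s (1 : R) X (phi (X s) - kappa s * psi (X s))
    & X t = x].

(* F(x, t) is the foot at time 0 of the characteristic through (x, t). *)
Definition backward_flow (R : realType) (phi psi kappa : R -> R)
    (F : R -> R -> R) : Prop :=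
  forall x t, 0 <= x < 1 -> 0 <= t ->
    exists2 X, characteristic phi psi kappa x t X & F x t = X 0.

(* Solution w, with associated function kappa, of the problem
     w_t + [phi(x) - kappa(t) psi(x)] w_x = w,  int_0^1 w(x, t) dx = 1,
   with initial data w0.  As w0 is in general only absolutely continuous, w need
   not be differentiable everywhere, and the equation is understood through
   characteristics: w(x, t) = e^t w0(F(x, t)). *)
Definition solution (R : realType) (phi psi w0 kappa : R -> R)
    (w : R -> R -> R) : Prop :=
  [/\ {within `[0, +oo[%classic, continuous kappa},
      forall t, 0 <= t -> 0 < kappa t,
      exists2 F, backward_flow phi psi kappa F &
        forall x t, 0 <= x < 1 -> 0 <= t -> w x t = expR t * w0 (F x t)
    & forall t, 0 <= t -> tail_integral (fun x => w x t) 0 = 1].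

(* Main.v *)
(** Write a = 1 - X for the gap of a characteristic X to the point 1, so that
    (ln a)' = kappa psi(X)/a - phi(X)/a.  Since psi and -phi are convex and
    vanish at 1, the quotients psi(x)/(1-x) and -phi(x)/(1-x) decrease to
    -psi'(1) and phi'(1) as x increases to 1; hence the quotient of the gaps of
    two characteristics is monotone in time, that is, F(., t) is convex.

    Near 1 the function h_0/w_0 has slope beta(., 0) - 1, so
    h_0(x)/w_0(x) ~ (1 - beta_0)(1 - x), and therefore
    ln w_0(x) ~ p ln(1 - x) with p = beta_0/(1 - beta_0).  Together with the
    convexity of F(., t) and int w = 1 this bounds w(0, t) above.  Conservation
    of mass then gives kappa psi(0) w(0, t) >= 1, the lower bound, and
    (-psi'(1) kappa + phi'(1)) (w(0, t) - 1) <= 1.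

    For the upper bound it remains to keep w(0, t) away from 1.  As
    e^t w_0(F(0, t)) = w(0, t) stays between positive constants, the
    characteristic ending at (0, t) has 1 - X(s) <= C e^{-(t-s)/q}, whence
    int_0^t (1 + kappa)(1 - X) ds is bounded uniformly in t.  So F(., t) is
    close to affine near x = 1, at the scale of 1 - F, and w(., t) cannot be
    flat up to 1.  The same estimate shows that -ln(1 - F(0, t)) differs from
    int_0^t (-psi'(1) kappa + phi'(1)) ds by a bounded amount, while
    ln w_0(F(0, t)) = -t + O(1) gives -ln(1 - F(0, t)) ~ t/p. *)
Require Import Defs.
From mathcomp Require Import ring lra.

Local Open Scope classical_set_scope.
Local Open Scope ring_scope.

Set Implicit Arguments.
Unset Strict Implicit.
Unset Printing Implicit Defensive.

(** * Derivatives and continuity of combinations of functions *)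

(** Since w_0 is only absolutely continuous, the conservation law cannot simply be differentiated in
    t. Instead, over a short interval [t, t + d] the backward flow is compared with an affine map x
    -> y + (1 - y) x, which fixes 1; as w(., t) is nonincreasing, a change of variables turns this
    into an inequality between masses. For the same reason the estimates on w_0 control increments
    and right slopes, not derivatives.

    No upper bound on kappa is at hand while w(0, t) is being kept away from 1. The errors, of size
    (1 + kappa)(1 - X), are therefore absorbed by the equation of the gap itself, which integrates
    kappa (1 - X) however large kappa is.

    Constants must be chosen before kappa and w. The margin of w(0, t) above 1 is thus found
    separately for t beyond a time T fixed by the data, and for t <= T, where a growth bound on gaps
    that is free of kappa suffices.

    The limit comes out as (1/p + A)/al with A = -phi'(1), al = -psi'(1) and 1/p = 1/beta_0 - 1. *)

Lemma is_derive_addf (R : realType) (f g : R -> R) (x a b : R) :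
  is_derive x (1 : R) f a -> is_derive x (1 : R) g b ->
  is_derive x (1 : R) (fun y => f y + g y) (a + b).
Proof. by move=> df dg; exact: (is_deriveD df dg). Qed.

Lemma is_derive_oppf (R : realType) (f : R -> R) (x a : R) :
  is_derive x (1 : R) f a -> is_derive x (1 : R) (fun y => - f y) (- a).
Proof. by move=> df; exact: (is_deriveN df). Qed.

Lemma is_derive_subf (R : realType) (f g : R -> R) (x a b : R) :
  is_derive x (1 : R) f a -> is_derive x (1 : R) g b ->
  is_derive x (1 : R) (fun y => f y - g y) (a - b).
Proof. by move=> df dg; exact: (is_deriveB df dg). Qed.

Lemma is_derive_mulf (R : realType) (f g : R -> R) (x a b : R) :
  is_derive x (1 : R) f a -> is_derive x (1 : R) g b ->
  is_derive x (1 : R) (fun y => f y * g y) (a * g x + f x * b).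
Proof.
move=> df dg; have := is_deriveM df dg; rewrite /GRing.scale/= addrC.
by rewrite (mulrC a).
Qed.

Lemma is_derive_cstf (R : realType) (c x : R) :
  is_derive x (1 : R) (fun=> c) 0.
Proof. exact: (is_derive_cst c x 1). Qed.

Lemma is_derive_idf (R : realType) (x : R) :
  is_derive x (1 : R) (fun y => y) 1.
Proof. exact: (is_derive_id x 1). Qed.

Lemma is_derive_expf (R : realType) (f : R -> R) (x a : R) :
  is_derive x (1 : R) f a ->
  is_derive x (1 : R) (fun y => expR (f y)) (expR (f x) * a).
Proof. by move=> df; apply: (@is_derive1_comp R expR f). Qed.

Lemma is_derive_lnf (R : realType) (f : R -> R) (x a : R) : 0 < f x ->
  is_derive x (1 : R) f a ->
  is_derive x (1 : R) (fun y => ln (f y)) (a / f x).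
Proof.
move=> f0 df; rewrite mulrC; apply: (@is_derive1_comp R (@ln R) f) => //.
exact: is_derive1_ln.
Qed.

Lemma is_derive_invf (R : realType) (f : R -> R) (x a : R) : f x != 0 ->
  is_derive x (1 : R) f a ->
  is_derive x (1 : R) (fun y => (f y)^-1) (- f x ^- 2 * a).
Proof. by move=> f0 df; exact: (is_deriveV f0 df). Qed.

Lemma within_continuousD (R : realType) (A : set R) (f g : R -> R) :
  {within A, continuous f} -> {within A, continuous g} ->
  {within A, continuous (fun y => f y + g y)}.
Proof. by move=> cf cg x; apply: cvgD; [exact: cf|exact: cg]. Qed.

Lemma within_continuousB (R : realType) (A : set R) (f g : R -> R) :
  {within A, continuous f} -> {within A, continuous g} ->
  {within A, continuous (fun y => f y - g y)}.
Proof. by move=> cf cg x; apply: cvgB; [exact: cf|exact: cg]. Qed.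

Lemma within_continuousN (R : realType) (A : set R) (f : R -> R) :
  {within A, continuous f} -> {within A, continuous (fun y => - f y)}.
Proof. by move=> cf x; apply: cvgN; exact: cf. Qed.

Lemma within_continuousM (R : realType) (A : set R) (f g : R -> R) :
  {within A, continuous f} -> {within A, continuous g} ->
  {within A, continuous (fun y => f y * g y)}.
Proof. by move=> cf cg x; apply: cvgM; [exact: cf|exact: cg]. Qed.

Lemma within_continuous_cst (R : realType) (A : set R) (c : R) :
  {within A, continuous (fun=> c)}.
Proof. by move=> x; exact: cvg_cst. Qed.

Lemma continuous_within_comp (R : realType) (A : set R) (f h : R -> R) :
  {within A, continuous f} -> (forall x, A x -> {for f x, continuous h}) ->
  {within A, continuous (fun y => h (f y))}.
Proof.
move=> cf ch; apply/subspace_continuousP => x Ax.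
move/subspace_continuousP : cf => /(_ x Ax) cf.
by apply: cvg_comp; [exact: cf|exact: ch].
Qed.

Lemma within_continuous_id (R : realType) (A : set R) :
  {within A, continuous (fun y : R => y)}.
Proof. by apply: continuous_subspaceT => x; exact: cvg_id. Qed.

Lemma within_continuous_exp (R : realType) (A : set R) (f : R -> R) :
  {within A, continuous f} -> {within A, continuous (fun y => expR (f y))}.
Proof.
by move=> cf; apply: (continuous_within_comp cf) => x _; exact: continuous_expR.
Qed.

Lemma within_continuous_ln (R : realType) (A : set R) (f : R -> R) :
  (forall x, A x -> 0 < f x) ->
  {within A, continuous f} -> {within A, continuous (fun y => ln (f y))}.
Proof.
move=> f0 cf; apply: (continuous_within_comp cf) => x Ax.
by apply: continuous_ln; exact: f0.
Qed.

Lemma is_derive_change (R : realType) (f : R -> R) (x a b : R) :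
  a = b -> is_derive x (1 : R) f a -> is_derive x (1 : R) f b.
Proof. by move=> ->. Qed.

Ltac der := repeat (first [ eassumption
  | notypeclasses refine (is_derive_cstf _ _)
  | notypeclasses refine (is_derive_idf _)
  | notypeclasses refine (is_derive_addf _ _)
  | notypeclasses refine (is_derive_oppf _)
  | notypeclasses refine (is_derive_mulf _ _)
  | notypeclasses refine (is_derive_expf _)
  | notypeclasses refine (is_derive_lnf _ _)
  | notypeclasses refine (is_derive_invf _ _) ]).

Ltac der_eq := notypeclasses refine (is_derive_change _ _); [|der].

Ltac cont := lazymatch goal with |- context [from_subspace _ ?f] =>
  lazymatch f with
  | fun _ => ?c => exact: within_continuous_cst
  | fun y => y => exact: within_continuous_id
  | fun y => GRing.add (@?g y) (@?h y) =>
      refine (@within_continuousD _ _ g h _ _); [cont|cont]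
  | fun y => GRing.opp (@?g y) => refine (@within_continuousN _ _ g _); cont
  | fun y => GRing.mul (@?g y) (@?h y) =>
      refine (@within_continuousM _ _ g h _ _); [cont|cont]
  | fun y => expR (@?g y) => refine (@within_continuous_exp _ _ g _); cont
  | fun y => ln (@?g y) =>
      first [assumption | refine (@within_continuous_ln _ _ g _ _); [|cont]]
  | _ => assumption
  end end.

Lemma is_derive_within_continuous (R : realType) (f f' : R -> R) (a b : R) :
  (forall x : R, a <= x <= b -> is_derive x (1 : R) f (f' x)) ->
  {within `[a, b], continuous f}.
Proof.
move=> df; apply: derivable_within_continuous => x; rewrite in_itv/= => xab.
exact: (@ex_derive _ _ _ _ _ _ _ (df x xab)).
Qed.

(** * Monotonicity from one-sided slopes *)

Lemma within_continuous_left (R : realType) (f : R -> R) (a b s : R) :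
  {within `[a, b], continuous f} -> a < s <= b -> f x @[x --> s^'-] --> f s.
Proof.
move=> cf /andP[as_ sb].
have : {within `[a, s], continuous f}.
  by apply: continuous_subspaceW cf; apply: subset_itvl; rewrite bnd_simp.
by move/(continuous_within_itvP _ as_) => [].
Qed.

Lemma within_continuous_right (R : realType) (f : R -> R) (a b s : R) :
  {within `[a, b], continuous f} -> a <= s < b -> f x @[x --> s^'+] --> f s.
Proof.
move=> cf /andP[as_ sb].
have : {within `[s, b], continuous f}.
  by apply: continuous_subspaceW cf; apply: subset_itvr; rewrite bnd_simp.
by move/(continuous_within_itvP _ sb) => [].
Qed.

(* No differentiability is assumed: the lemma is applied to expressions in the
   initial profile, whose density is merely integrable. *)
Lemma right_slope_le (R : realType) (f : R -> R) (a b e : R) : a <= b ->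
  {within `[a, b], continuous f} ->
  (forall x, a <= x < b ->
     \forall z \near x^'+, f z - f x <= e * (z - x)) ->
  f b - f a <= e * (b - a).
Proof.
move=> ab cf Hs.
(* Continuity induction: left continuity puts [sup S] in [S], and if [sup S] were below [b] its
   right slope would produce a larger element. *)
pose S := [set x | a <= x <= b /\ f x - f a <= e * (x - a)].
have Sa : S a by split; rewrite ?lexx ?ab ?subrr ?mulr0.
have ubS : ubound S b by move=> x [/andP[]].
have hsS : has_sup S by split; [exists a | exists b].
set s := sup S.
have as_ : a <= s by apply: (ub_le_sup hsS.2 Sa).
have sb : s <= b by apply: (ge_sup _ ubS); exists a.
have Ss : S s.
  split; first by rewrite as_ sb.
  rewrite leNgt; apply/negP => hgt.
  have [eas|ltas] := eqVneq a s.
    by move: hgt; rewrite -eas !subrr mulr0 ltxx.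
  have {}ltas : a < s by rewrite lt_neqAle ltas.
  have cfs : f x - f a - e * (x - a) @[x --> s^'-] --> f s - f a - e * (s - a).
    apply: cvgB; first by apply: cvgB; [apply: (within_continuous_left cf); rewrite ltas|exact: cvg_cst].
    apply: cvgM; first exact: cvg_cst.
    by apply: cvgB; [exact/cvg_at_left_filter/cvg_id|exact: cvg_cst].
  have pos : 0 < f s - f a - e * (s - a) by rewrite subr_gt0.
  have : \forall x \near s^'-, 0 < f x - f a - e * (x - a).
    by apply: (cvgr_gt _ cfs).
  move=> [d /= d0 Hd].
  have [x Sx xs] := sup_adherent d0 hsS.
  have xles : x <= s by apply: ub_le_sup Sx; exact: hsS.2.
  have : x != s.
    by apply/eqP => xes; move: Sx; rewrite xes => -[_]; rewrite leNgt hgt.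
  move=> xns; have xlts : x < s by rewrite lt_neqAle xns.
  have := Hd x _ xlts; rewrite /= ger0_norm ?subr_ge0//.
  rewrite ltrBlDr -ltrBlDl xs => /(_ isT).
  by case: Sx => _; lra.
have [<-|nsb] := eqVneq s b; first by case: Ss.
have ltsb : s < b by rewrite lt_neqAle nsb.
have H1 := Hs s; rewrite as_ ltsb in H1.
have H2 : \forall z \near s^'+, z <= b by exact: nbhs_right_le.
have H3 : \forall z \near s^'+, [/\ f z - f s <= e * (z - s), z <= b & s < z].
  near=> z; split; near: z; [exact: H1|exact: H2|exact: nbhs_right_gt].
have [z [{}H3 zb sz]] := @filter_ex _ _ (at_right_proper_filter s) _ H3.
have Sz : S z.
  split; first by rewrite (le_trans as_ (ltW sz)).
  by case: Ss => _; lra.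
by have := ub_le_sup hsS.2 Sz; rewrite leNgt -/s sz.
Unshelve. all: by end_near. Qed.

(** Only interior slopes are controlled, as an equation on an open interval gives nothing at [a].
    The bound is started at a' > a, and right continuity lets a' tend to [a]; the total slack is
    made small by scaling [e]. *)
Lemma right_slope_le0 (R : realType) (f : R -> R) (a b : R) : a <= b ->
  {within `[a, b], continuous f} ->
  (forall e x, 0 < e -> a < x < b ->
     \forall z \near x^'+, f z - f x <= e * (z - x)) ->
  f b <= f a.
Proof.
move=> + cf Hs; rewrite le_eqVlt => /predU1P[->//|ab].
have H a' : a < a' < b -> f b <= f a'.
  move=> /andP[aa' a'b]; rewrite -subr_le0; apply/ler_addgt0Pr => e e0.
  rewrite add0r.
  have d0 : 0 < e / (b - a') by rewrite divr_gt0// subr_gt0.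
  rewrite -(@divfK _ (b - a') _ e); last by rewrite gt_eqF// subr_gt0.
  apply: right_slope_le => //; first exact: ltW.
    apply: continuous_subspaceW cf; apply: subset_itvr; rewrite bnd_simp; exact: ltW.
  move=> x /andP[a'x xb]; apply: Hs => //; rewrite xb andbT.
  exact: lt_le_trans a'x.
have cfa := @within_continuous_right _ f a b a cf.
rewrite lexx ab in cfa; have {}cfa := cfa isT.
rewrite -(cvg_lim _ cfa)//; apply: limr_ge; first by apply: cvgP cfa.
near=> x; apply: H; apply/andP; split; near: x.
  exact: nbhs_right_gt.
exact: nbhs_right_lt.
Unshelve. all: by end_near. Qed.

Lemma derive_le0_le (R : realType) (f f' : R -> R) (a b : R) : a <= b ->
  {within `[a, b], continuous f} ->
  (forall x, a < x < b -> is_derive x 1 f (f' x)) ->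
  (forall x, a < x < b -> f' x <= 0) -> f b <= f a.
Proof.
rewrite le_eqVlt => /predU1P[->//|ab] cf df f'0.
have [c cab E] := MVT ab df cf.
rewrite -subr_le0 E mulr_le0_ge0 ?subr_ge0 ?(ltW ab)//; exact: f'0.
Qed.

Lemma at_left_lim_le (R : realType) (f : R -> R) (y b L M : R) : y < b ->
  f x @[x --> b^'-] --> L -> (forall x, y < x < b -> f x <= M) -> L <= M.
Proof.
move=> yb fL fM; rewrite -(cvg_lim _ fL)//; apply: limr_le; first exact: cvgP fL.
near=> x; apply: fM; apply/andP; split; near: x.
  exact: nbhs_left_gt.
exact: nbhs_left_lt.
Unshelve. all: by end_near. Qed.

(** * Integrals over [x, 1[ *)

Lemma tail_integral1 (R : realType) (f : R -> R) : tail_integral f 1 = 0.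
Proof. by rewrite /tail_integral set_itvco0 Rintegral_set0. Qed.

Lemma tail_integralB (R : realType) (f : R -> R) (x y : R) :
  lebesgue_measure.-integrable `[0%R, 1%R[ (EFin \o f) -> 0 <= x <= y -> y <= 1 ->
  tail_integral f x - tail_integral f y =
    \int[lebesgue_measure]_(z in `[x, y[) f z.
Proof.
move=> fi /andP[x0 xy] y1; rewrite /tail_integral.
rewrite (@itv_bndbnd_setU _ _ (BLeft x) (BLeft y) (BLeft 1))//.
rewrite Rintegral_setU ?addrK//=.
  rewrite -itv_bndbnd_setU//; apply: integrableS fi => //.
  by apply: subset_itvr; rewrite bnd_simp.
apply/disj_setPS => z [/=]; rewrite 2!in_itv/= => /andP[_ zy] /andP[].
by rewrite leNgt zy.
Qed.

Lemma Rintegral_co_cst (R : realType) (x y M : R) : x <= y ->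
  \int[lebesgue_measure]_(z in `[x, y[) M = M * (y - x).
Proof.
move=> xy; rewrite Rintegral_cst//= lebesgue_measure_itv/= lte_fin.
case: ltgtP xy => [xy _|//|->] /=; first by [].
by rewrite subrr !mulr0.
Qed.

Lemma integrable_co_cst (R : realType) (x y M : R) :
  lebesgue_measure.-integrable `[x, y[ (EFin \o cst M).
Proof.
apply: measurable_bounded_integrable => //=.
- by rewrite lebesgue_measure_itv/=; case: ifP => _; rewrite -?EFinD ltry.
- exact: bounded_cst.
Qed.

Lemma tail_integralB_le (R : realType) (f : R -> R) (x y M : R) :
  lebesgue_measure.-integrable `[0%R, 1%R[ (EFin \o f) -> 0 <= x <= y -> y <= 1 ->
  (forall z, x <= z < y -> f z <= M) ->
  tail_integral f x - tail_integral f y <= M * (y - x).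
Proof.
move=> fi xy y1 fM; rewrite tail_integralB//; case/andP: xy => x0 xy.
rewrite -Rintegral_co_cst//; apply: le_Rintegral => //=.
  by apply: integrableS fi => //; apply: subset_itv; rewrite bnd_simp.
exact: integrable_co_cst.
Qed.

Lemma tail_integralB_ge (R : realType) (f : R -> R) (x y M : R) :
  lebesgue_measure.-integrable `[0%R, 1%R[ (EFin \o f) -> 0 <= x <= y -> y <= 1 ->
  (forall z, x <= z < y -> M <= f z) ->
  M * (y - x) <= tail_integral f x - tail_integral f y.
Proof.
move=> fi xy y1 fM; rewrite tail_integralB//; case/andP: xy => x0 xy.
rewrite -Rintegral_co_cst//; apply: le_Rintegral => //=.
  exact: integrable_co_cst.
by apply: integrableS fi => //; apply: subset_itv; rewrite bnd_simp.
Qed.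

Lemma le_tail_integral (R : realType) (f g : R -> R) (x : R) : 0 <= x ->
  lebesgue_measure.-integrable `[0%R, 1%R[ (EFin \o f) ->
  lebesgue_measure.-integrable `[0%R, 1%R[ (EFin \o g) ->
  (forall z, x <= z < 1 -> f z <= g z) ->
  tail_integral f x <= tail_integral g x.
Proof.
move=> x0 fi gi fg; apply: le_Rintegral => //=.
  by apply: integrableS fi => //; apply: subset_itv; rewrite bnd_simp.
by apply: integrableS gi => //; apply: subset_itv; rewrite bnd_simp.
Qed.

Lemma eq_tail_integral (R : realType) (f g : R -> R) (x : R) :
  (forall z, x <= z < 1 -> f z = g z) -> tail_integral f x = tail_integral g x.
Proof. by move=> fg; apply: eq_Rintegral => z /set_mem/= /fg. Qed.

Lemma tail_integralZ (R : realType) (f : R -> R) (k x : R) : 0 <= x ->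
  lebesgue_measure.-integrable `[0%R, 1%R[ (EFin \o f) ->
  tail_integral (fun z => k * f z) x = k * tail_integral f x.
Proof.
move=> x0 fi; apply: RintegralZl => //=.
by apply: integrableS fi => //; apply: subset_itv; rewrite bnd_simp.
Qed.

Lemma within_continuous_integrable (R : realType) (f : R -> R) :
  {within `[0, 1], continuous f} ->
  lebesgue_measure.-integrable `[0%R, 1%R[ (EFin \o f).
Proof.
move=> cf; have := continuous_compact_integrable (@segment_compact R 0 1) cf.
by apply: integrableS => //; apply: subset_itv; rewrite bnd_simp.
Qed.

Lemma tail_integral_continuous (R : realType) (f : R -> R) :
  lebesgue_measure.-integrable `[0%R, 1%R[ (EFin \o f) ->
  {within `[0, 1], continuous (tail_integral f)}.
Proof.
move=> fi.
have fi' : lebesgue_measure.-integrable `[0%R, 1%R] (EFin \o f).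
  rewrite (@itv_bndbnd_setU _ _ (BLeft 0) (BLeft 1) (BRight 1)) ?bnd_simp//.
  apply/integrableP; split.
    apply/measurable_funU => //; split; first by case/integrableP: fi.
    by rewrite set_itv1; exact: measurable_fun_set1.
  rewrite -itv_bndbnd_setU ?bnd_simp// -integral_itv_bndo_bndc; last first.
    by have /integrableP[] := integrable_abse fi.
  by case/integrableP: fi.
have cF := parameterized_integral_continuous (@ler01 R) fi'.
pose G x := tail_integral f 0 - parameterized_integral lebesgue_measure 0 x f.
have cG : {within `[0, 1], continuous G}.
  by move=> x; apply: cvgB; [exact: cvg_cst|exact: cF].
apply: (subspace_eq_continuous _ cG) => x; rewrite inE/= in_itv/= => /andP[x0 x1].
rewrite /G /from_subspace /parameterized_integral -Rintegral_itv_bndo_bndc; last first.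
  by apply: integrableS fi => //; apply: subset_itv; rewrite bnd_simp.
by rewrite -tail_integralB ?lexx ?x0// subKr.
Qed.

(** Change of variables along the affine map of [0, 1[ onto [y, 1[; it is what lets the mass at time
    t + d be compared with part of the mass at time t. *)
Lemma tail_integral_affine (R : realType) (U : R -> R) (y : R) :
  {within `[0, 1], continuous U} -> 0 <= y < 1 ->
  (1 - y) * tail_integral (fun x => U (y + (1 - y) * x)) 0 = tail_integral U y.
Proof.
move=> cU /andP[y0 y1].
pose F (x : R) : R := y + (1 - y) * x.
have y1' : 0 < 1 - y by rewrite subr_gt0.
have dF (x : R) : is_derive x (1 : R) F (1 - y).
  by der_eq; rewrite /=; ring.
have Flt a b : a < b -> F a < F b by move=> ab; rewrite /F ltrD2l ltr_pM2l.
have F0 : F 0 = y by rewrite /F mulr0 addr0.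
have F1 : F 1 = 1 by rewrite /F mulr1 addrC subrK.
have F'E : F^`()%classic = cst (1 - y).
  by apply/funext => x; rewrite derive1E; apply: derive_val.
have cF : continuous F by move=> x; apply: differentiable_continuous; apply/derivable1_diffP; apply: (@ex_derive _ _ _ _ _ _ _ (dF x)).
have cU' : {within `[F 0, F 1], continuous U}.
  by rewrite F0 F1; apply: continuous_subspaceW cU; apply: subset_itvr; rewrite bnd_simp.
have := @integration_by_substitution_increasing R F U 0 1 ler01.
have cUF : {within `[0, 1], continuous (U \o F)}.
  apply/(continuous_within_itvP _ ltr01); split.
  - move=> x /[!in_itv]/= /andP[x0 x1].
    apply: continuous_comp; first exact: cF.
    have FF : F 0 < F 1 by rewrite F0 F1.
    move/(continuous_within_itvP _ FF) : cU' => [+ _ _]; apply.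
    by rewrite in_itv/= !Flt.
  - have cUy : U x @[x --> y^'+] --> U y.
      by apply: (within_continuous_right cU); rewrite y0 y1.
    rewrite /= F0.
    apply: cvg_comp cUy => A; rewrite /nbhs/= => -[d /= d0 HA].
    exists d => //= x; rewrite /ball_/= sub0r normrN => xd x0.
    apply: HA => /=; last by rewrite -F0 Flt.
    rewrite /F opprD addrA subrr sub0r normrN normrM.
    apply: le_lt_trans xd; rewrite ler_piMl// gtr0_norm//; lra.
  - have cU1 : U x @[x --> 1^'-] --> U 1.
      by apply: (within_continuous_left cU); rewrite ltr01 lexx.
    rewrite /= F1.
    apply: cvg_comp cU1 => A; rewrite /nbhs/= => -[d /= d0 HA].
    exists d => //= x; rewrite /ball_/= => xd x1.
    apply: HA => /=; last by rewrite -F1 Flt.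
    have -> : 1 - F x = (1 - y) * (1 - x) by rewrite /F; ring.
    rewrite normrM.
    apply: le_lt_trans xd; rewrite ler_piMl// gtr0_norm//; lra.
rewrite F'E F0 F1 => H.
have {}H : (\int[lebesgue_measure]_(x in `[y, 1%R]) (U x)%:E)%E =
    (\int[lebesgue_measure]_(x in `[0%R, 1%R]) ((U (F x)) * (1 - y))%:E)%E.
  apply: H.
  - by move=> a b _ _; exact: Flt.
  - by move=> x _; exact: cst_continuous.
  - exact: is_cvg_cst.
  - exact: is_cvg_cst.
  - split.
    + by move=> x _; exact: (@ex_derive _ _ _ _ _ _ _ (dF x)).
    + by apply: cvg_at_right_filter; exact: cF.
    + by apply: cvg_at_left_filter; exact: cF.
  - by move: cU'; rewrite F0 F1.
have iU := within_continuous_integrable cU.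
have iUF := within_continuous_integrable cUF.
rewrite /tail_integral !Rintegral_itv_bndo_bndc//; last first.
  by apply: integrableS iU => //; apply: subset_itv; rewrite bnd_simp.
have := continuous_compact_integrable (@segment_compact R 0 1) cUF.
move=> iUF'; rewrite mulrC -[LHS]RintegralZr//.
by rewrite /Rintegral H.
Qed.

(** * Secant slopes of the coefficients at 1 *)

Lemma diff_quot_is_derive (R : realType) (f : R -> R) (x l : R) :
  diff_quot f x y @[y --> x^'] --> l -> is_derive x (1 : R) f l.
Proof.
move=> fl.
have H : h^-1 *: ((f \o shift x) (h *: (1 : R)) - f x) @[h --> (0 : R)^'] --> l.
  apply/cvgrPdist_lt => e e0; move/cvgrPdist_lt : fl => /(_ e e0)[d /= d0 Hd].
  exists d => //= h; rewrite /ball_/= sub0r normrN => hd h0.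
  have := Hd (h + x); rewrite /ball_/= opprD addrCA subrr addr0 normrN => /(_ hd).
  rewrite -subr_eq0 addrK => /(_ h0).
  by rewrite /diff_quot addrK /GRing.scale/= mulr1 mulrC.
apply: DeriveDef; first exact: (cvgP _ H).
by apply: (cvg_lim _ H).
Qed.

Lemma derivable_in_is_derive (R : realType) (f : R -> R) (x : R) : 0 < x < 1 ->
  derivable_in `]0, 1]%classic f x ->
  is_derive x (1 : R) f (deriv_in `]0, 1]%classic f x).
Proof.
move=> /andP[x0 x1] df; apply: diff_quot_is_derive.
rewrite /derivable_in -/(deriv_in _ _ _) in df.
apply: cvg_trans df => U [d /= d0 HU].
exists (Num.min d (Num.min x (1 - x))) => /=.
  by rewrite !lt_min d0 x0 subr_gt0 x1.
move=> y; rewrite /ball_/= !lt_min => /andP[xyd /andP[xyx xy1]] yx.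
apply: HU => //=; rewrite in_itv/=; apply/andP; split.
  by move: xyx; rewrite ltr_norml => /andP[]; lra.
by move: xy1; rewrite ltr_norml => /andP[]; lra.
Qed.

Lemma derivable_in_left (R : realType) (f : R -> R) :
  derivable_in `]0, 1]%classic f 1 ->
  diff_quot f 1 y @[y --> 1^'-] --> deriv_in `]0, 1]%classic f 1.
Proof.
move=> df; rewrite /derivable_in -/(deriv_in _ _ _) in df.
apply: cvg_trans df => U [d /= d0 HU].
exists (Num.min d 1) => /=; first by rewrite lt_min d0 ltr01.
move=> y; rewrite /ball_/= lt_min => /andP[xyd xy1] y1.
apply: HU => //=; rewrite ?in_itv/= ?lt_eqF//; apply/andP; split; last exact: ltW.
by move: xy1; rewrite ltr_norml => /andP[]; lra.
Qed.

(** The second derivative is continuous on the compact interval [1/2, 1], hence bounded there.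
    Nothing similar holds near 0, where the first derivative may blow up; this is why later
    estimates keep characteristics in [1/2, 1]. *)
Lemma C2_in_lipschitz (R : realType) (f : R -> R) : C_in 2 `]0, 1]%classic f ->
  (forall x : R, 0 < x < 1 -> is_derive x (1 : R) f (deriv_in `]0, 1]%classic f x)) /\
  exists2 L, 0 <= L & forall x y : R, 1 / 2 <= x <= y -> y < 1 ->
    `|deriv_in `]0, 1]%classic f x - deriv_in `]0, 1]%classic f y| <= L * (y - x).
Proof.
move=> [df [ddf cf]]; split=> [x x01|].
  apply: derivable_in_is_derive => //; apply: df => /=.
  by rewrite in_itv/=; case/andP: x01 => -> /ltW.
set f' := deriv_in _ f in ddf cf *; set f'' := deriv_in _ f' in cf.
have cf2 : {within `[1 / 2, 1], continuous f''}.
  apply: continuous_subspaceW cf => x /=; rewrite !in_itv/= => /andP[x2 ->].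
  by rewrite andbT; lra.
have cf2n : {within `[1 / 2, 1], continuous (fun x => `|f'' x|)}.
  by apply: (continuous_within_comp cf2) => x _; exact: norm_continuous.
have h1 : 1 / 2 <= 1 :> R by lra.
have [c _ Hc] := EVT_max h1 cf2n.
exists (`|f'' c|) => // x y /andP[x2 xy] y1.
have d2 (z : R) : 0 < z < 1 -> is_derive z (1 : R) f' (f'' z).
  move=> z01; apply: derivable_in_is_derive => //; apply: ddf => /=.
  by rewrite in_itv/=; case/andP: z01 => -> /ltW.
have [z||] := @MVT_segment R f' f'' x y xy.
- rewrite in_itv/= => /andP[xz zy]; apply: d2; apply/andP; split; lra.
- apply: (@is_derive_within_continuous _ _ f'') => z /andP[xz zy].
  by apply: d2; apply/andP; split; lra.
move=> z; rewrite in_itv/= => /andP[xz zy] E.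
rewrite distrC E normrM (ger0_norm (_ : 0 <= y - x)) ?subr_ge0//.
rewrite ler_wpM2r ?subr_ge0//; apply: Hc; rewrite in_itv/=; apply/andP; split; lra.
Qed.

Lemma convex_function_segment (R : realType) (f : R -> R) (t x y : R) :
  convex_function (`[0, 1]%classic : set R^o) (f : R^o -> R^o) ->
  0 <= t <= 1 -> 0 <= x <= 1 -> 0 <= y <= 1 ->
  f (t * x + (1 - t) * y) <= t * f x + (1 - t) * f y.
Proof.
move=> cf /andP[t0 t1] x01 y01.
have := cf (Itv01 t0 t1) x y; rewrite !inE/= !in_itv/= => /(_ x01 y01).
by rewrite !convRE.
Qed.

(** When [f 1 = 0], this is minus the slope of the chord from x to 1. At x = 1 division by zero
    makes it 0, so statements about it stay below 1. *)
Definition slope1 (R : realType) (f : R -> R) (x : R) : R := f x / (1 - x).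

Lemma slope1_noninc (R : realType) (f : R -> R) (x y : R) :
  convex_function (`[0, 1]%classic : set R^o) (f : R^o -> R^o) -> f 1 = 0 ->
  0 <= x <= y -> y < 1 -> slope1 f y <= slope1 f x.
Proof.
move=> cf f1 /andP[x0 xy] y1; have x1 := le_lt_trans xy y1.
rewrite /slope1 ler_pdivrMr ?subr_gt0// mulrAC ler_pdivlMr ?subr_gt0//.
have := @convex_function_segment R f ((1 - y) / (1 - x)) x 1 cf.
rewrite f1 mulr0 addr0 mulr1.
have -> : (1 - y) / (1 - x) * x + (1 - (1 - y) / (1 - x)) = y.
  by field; rewrite gt_eqF// subr_gt0.
rewrite divr_ge0 ?subr_ge0 ?(ltW x1) ?(ltW y1)//.
rewrite ler_pdivrMr ?subr_gt0// mul1r lerD2l lerN2 xy.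
rewrite x0 ler01 lexx => /(_ isT isT isT).
rewrite -(ler_pM2r (_ : 0 < 1 - x)) ?subr_gt0// => /le_trans; apply.
by rewrite mulrAC divfK ?gt_eqF ?subr_gt0// mulrC.
Qed.

Lemma slope1_left (R : realType) (f : R -> R) :
  f 1 = 0 -> derivable_in `]0, 1]%classic f 1 ->
  slope1 f y @[y --> 1^'-] --> - deriv_in `]0, 1]%classic f 1.
Proof.
move=> f1 /derivable_in_left df.
rewrite (_ : slope1 f = fun y => - diff_quot f 1 y); first exact: cvgN.
by apply/funext => y; rewrite /slope1 /diff_quot f1 subr0 -(opprB 1 y) invrN mulrN opprK.
Qed.

Lemma slope1_ge (R : realType) (f : R -> R) (m x : R) :
  convex_function (`[0, 1]%classic : set R^o) (f : R^o -> R^o) -> f 1 = 0 ->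
  slope1 f y @[y --> 1^'-] --> m -> 0 <= x < 1 -> m <= slope1 f x.
Proof.
move=> cf f1 df /andP[x0 x1]; apply: (at_left_lim_le x1 df).
by move=> y /andP[xy y1]; apply: slope1_noninc; rewrite ?x0 ?(ltW xy).
Qed.

(** A chord of a convex function is no steeper upwards than the tangent at 1, whose slope is -m.
    With g the quotient at y, f y = g (1 - y) and f x >= g (1 - x), while g >= m. *)
Lemma convex_increment_le (R : realType) (f : R -> R) (m x y : R) :
  convex_function (`[0, 1]%classic : set R^o) (f : R^o -> R^o) -> f 1 = 0 ->
  slope1 f y @[y --> 1^'-] --> m -> 0 <= x <= y -> y <= 1 ->
  f y - f x <= - m * (y - x).
Proof.
move=> cf f1 df /andP[x0 xy]; rewrite le_eqVlt => /predU1P[y1|y1].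
  have [x1|] := ltP x 1; last first.
    move=> x1; have -> : x = y by apply/eqP; rewrite eq_le xy y1.
    by rewrite !subrr mulr0.
  have := @slope1_ge R f m x cf f1 df; rewrite x0 x1 => /(_ isT).
  by rewrite /slope1 ler_pdivlMr ?subr_gt0// y1 f1; lra.
have x1 := le_lt_trans xy y1.
have := @slope1_noninc R f x y cf f1; rewrite x0 xy y1 => /(_ isT isT).
have := @slope1_ge R f m y cf f1 df; rewrite (le_trans x0 xy) y1 => /(_ isT).
set g := slope1 f y => mg.
rewrite /slope1 ler_pdivlMr ?subr_gt0// => gf.
have : f y = g * (1 - y) by rewrite /g /slope1 divfK// gt_eqF// subr_gt0.
have : 0 <= (g - m) * (y - x) by rewrite mulr_ge0 ?subr_ge0//; lra.
lra.
Qed.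

Lemma slope1_lipschitz (R : realType) (f f' : R -> R) (L x y : R) :
  {within `[0, 1], continuous f} -> f 1 = 0 ->
  (forall z : R, 0 < z < 1 -> is_derive z (1 : R) f (f' z)) -> 0 <= L ->
  (forall z t : R, 1 / 2 <= z <= t -> t < 1 -> `|f' z - f' t| <= L * (t - z)) ->
  1 / 2 <= x <= y -> y < 1 -> `|slope1 f x - slope1 f y| <= L * (y - x).
Proof.
move=> cf f1 df L0 lf /andP[x2 xy] y1.
have dg (z : R) : 0 < z < 1 ->
    is_derive z (1 : R) (slope1 f) ((f' z * (1 - z) + f z) / (1 - z) ^+ 2).
  move=> /andP[z0 z1].
  have dfz : is_derive z (1 : R) f (f' z) by apply: df; rewrite z0.
  have nz : 1 - z != 0 by rewrite gt_eqF// subr_gt0.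
  by rewrite /slope1; der_eq; rewrite //=; field.
have [z||] := @MVT_segment R (slope1 f)
    (fun z => (f' z * (1 - z) + f z) / (1 - z) ^+ 2) x y xy.
- rewrite in_itv/= => /andP[xz zy]; apply: dg; apply/andP; split; lra.
- apply: is_derive_within_continuous => z /andP[xz zy].
  by apply: dg; apply/andP; split; lra.
move=> z; rewrite in_itv/= => /andP[xz zy] E.
rewrite distrC E normrM (ger0_norm (_ : 0 <= y - x)) ?subr_ge0//.
rewrite ler_wpM2r ?subr_ge0//.
have z1 : z < 1 by lra.
(* A second mean value, f z = -f'(c)(1 - z), turns the derivative of [slope1 f] at z into (f'(z) -
   f'(c))/(1 - z), which the Lipschitz bound controls by L because c < 1. *)
have [t||c] := @MVT R f f' z 1 z1.
- rewrite in_itv/= => /andP[zt t1]; apply: df; apply/andP; split; lra.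
- by apply: continuous_subspaceW cf; apply: subset_itvr; rewrite bnd_simp; lra.
rewrite in_itv/= f1 sub0r => /andP[zc c1] E2.
have {E2}-> : f z = - f' c * (1 - z) by rewrite mulNr -E2 opprK.
have -> : (f' z * (1 - z) + - f' c * (1 - z)) / (1 - z) ^+ 2 = (f' z - f' c) / (1 - z).
  by field; rewrite gt_eqF// subr_gt0.
rewrite normrM normfV (gtr0_norm (_ : 0 < 1 - z)) ?subr_gt0//.
rewrite ler_pdivrMr ?subr_gt0//; apply: (@le_trans _ _ (L * (c - z))).
  by apply: lf => //; apply/andP; split; lra.
by rewrite ler_wpM2l//; lra.
Qed.

Lemma slope1_le (R : realType) (f f' : R -> R) (m L : R) :
  {within `[0, 1], continuous f} ->
  convex_function (`[0, 1]%classic : set R^o) (f : R^o -> R^o) -> f 1 = 0 ->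
  (forall z : R, 0 < z < 1 -> is_derive z (1 : R) f (f' z)) -> 0 <= L ->
  (forall z t : R, 1 / 2 <= z <= t -> t < 1 -> `|f' z - f' t| <= L * (t - z)) ->
  slope1 f y @[y --> 1^'-] --> m ->
  exists2 K, 0 <= K & forall x : R,
    (forall y, 1 / 2 <= x <= y -> y < 1 -> slope1 f x - slope1 f y <= K * (y - x)) /\
    (0 <= x < 1 -> slope1 f x <= m + K * (1 - x)).
Proof.
move=> cf convf f1 df L0 lf cs.
have lip x y : 1 / 2 <= x <= y -> y < 1 ->
    slope1 f x - slope1 f y <= L * (y - x).
  move=> xy y1; apply: le_trans (ler_norm _) _.
  exact: (slope1_lipschitz cf f1 df).
(* On [1/2, 1[ the Lipschitz bound passes to the limit at 1. Below 1/2 the quotient is at most its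
   value [f 0] at 0, and 2 (1 - x) >= 1 pays for the difference to m. *)
exists (L + 2 * `|f 0 - m|); first by rewrite addr_ge0// mulr_ge0.
have N0 := normr_ge0 (f 0 - m).
move=> x; split=> [y xy y1|/andP[x0 x1]].
  apply: le_trans (lip _ _ xy y1) _; rewrite ler_wpM2r ?subr_ge0//.
    by case/andP: xy.
  by rewrite lerDl mulr_ge0.
have [x2|/ltW x2] := leP (1 / 2) x.
  apply: (@le_trans _ _ (m + L * (1 - x))); last first.
    by rewrite lerD2l ler_wpM2r ?subr_ge0 ?(ltW x1)// lerDl mulr_ge0.
  rewrite -lerBlDr.
  have cv : slope1 f x - L * (y - x) @[y --> 1^'-] --> slope1 f x - L * (1 - x).
    apply: cvgB; first exact: cvg_cst.
    apply: cvgM; first exact: cvg_cst.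
    by apply: cvgB; [exact/cvg_at_left_filter/cvg_id|exact: cvg_cst].
  rewrite -(cvg_lim _ cv)// -(cvg_lim _ cs)//; apply: ler_lim.
  - exact: cvgP cv.
  - exact: cvgP cs.
  near=> y.
    have xy : x <= y by near: y; exact: nbhs_left_ge.
    have y1 : y < 1 by near: y; exact: nbhs_left_lt.
    by have := lip x y; rewrite x2 xy y1 => /(_ isT isT); lra.
have := @slope1_noninc R f 0 x convf f1; rewrite lexx x0 x1 => /(_ isT isT).
rewrite {2}/slope1 subr0 divr1 => H; apply: (le_trans H).
have : f 0 - m <= `|f 0 - m| by exact: ler_norm.
have : 0 <= L * (1 - x) by rewrite mulr_ge0// subr_ge0 ltW.
have : 0 <= `|f 0 - m| * (2 * (1 - x) - 1) by rewrite mulr_ge0//; lra.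
lra.
Unshelve. all: by end_near. Qed.

(** The form in which the coefficients enter all the estimates: [al] is -psi'(1), [A] is -phi'(1),
    [B] is psi(0), and [L] measures how fast the chord slopes approach their limits at 1. *)
Record drift_bounds (R : realType) (phi psi : R -> R) (al A B L : R) : Prop := {
  db_al : 0 < al;
  db_A : 0 <= A;
  db_B : 0 <= B;
  db_L : 0 <= L;
  db_phi1 : phi 1 = 0;
  db_psi1 : psi 1 = 0;
  db_phi_ge0 : forall x : R, 0 <= x <= 1 -> 0 <= phi x;
  db_phi_incr : forall x y : R, 0 <= x <= y -> y <= 1 ->
    - A * (y - x) <= phi y - phi x;
  db_psi_incr : forall x y : R, 0 <= x <= y -> y <= 1 ->
    psi y - psi x <= - al * (y - x);
  db_psi_le : forall x : R, 0 <= x <= 1 -> psi x <= B * (1 - x);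
  db_phi_slope : forall x y : R, 0 <= x <= y -> y < 1 ->
    slope1 phi x <= slope1 phi y;
  db_psi_slope : forall x y : R, 0 <= x <= y -> y < 1 ->
    slope1 psi y <= slope1 psi x;
  db_phi_lip : forall x y : R, 1 / 2 <= x <= y -> y < 1 ->
    slope1 phi y - slope1 phi x <= L * (y - x);
  db_psi_lip : forall x y : R, 1 / 2 <= x <= y -> y < 1 ->
    slope1 psi x - slope1 psi y <= L * (y - x);
  db_phi_lim : forall x : R, 0 <= x < 1 -> A - L * (1 - x) <= slope1 phi x;
  db_psi_lim : forall x : R, 0 <= x < 1 -> slope1 psi x <= al + L * (1 - x) }.

Lemma coefficients_drift_bounds (R : realType) (phi psi : R -> R) :
  coefficients phi psi ->
  exists L, drift_bounds phi psi (- deriv_n 1 psi 1) (- deriv_n 1 phi 1) (psi 0) L.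
Proof.
move=> [[cphi cpsi Cphi Cpsi] [[convphi phi0 phi1 /andP[_ dphi1]]
  [convpsi psi1 dpsi1 _]]].
have one : `]0, 1]%classic (1 : R) by rewrite /= in_itv/= ltr01 lexx.
have lphi : slope1 phi y @[y --> 1^'-] --> - deriv_n 1 phi 1.
  exact: slope1_left phi1 (Cphi.1 _ one).
have lpsi : slope1 psi y @[y --> 1^'-] --> - deriv_n 1 psi 1.
  exact: slope1_left psi1 (Cpsi.1 _ one).
have [dphi [K K0 HK]] := C2_in_lipschitz Cphi.
have [dpsi [K' K'0 HK']] := C2_in_lipschitz Cpsi.
have nphi1 : - phi 1 = 0 by rewrite phi1 oppr0.
have cnphi := within_continuousN cphi.
have slopeN x : slope1 (fun y => - phi y) x = - slope1 phi x.
  by rewrite /slope1 mulNr.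
have lnphi : slope1 (fun y => - phi y) y @[y --> 1^'-] --> deriv_n 1 phi 1.
  rewrite -(opprK (deriv_n 1 phi 1)).
  have -> : slope1 (fun y => - phi y) = fun y => - slope1 phi y by apply/funext.
  exact: cvgN.
have dnphi (z : R) (z01 : 0 < z < 1) := is_derive_oppf (dphi z z01).
have [|L L0 HL] := @slope1_le R (fun y => - phi y) _ _ K cnphi convphi nphi1 dnphi K0 _ lnphi.
  by move=> z t zt t1; rewrite -opprD normrN; exact: HK.
have [L' L'0 HL'] := @slope1_le R psi _ _ K' cpsi convpsi psi1 dpsi K'0 HK' lpsi.
(* The bounds on phi are those for convex functions applied to - phi; the sum of the two constants
   serves both coefficients. *)
exists (L + L'); split => //.
- by rewrite oppr_gt0.
- by rewrite oppr_ge0 ltW.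
- have := @slope1_ge R psi _ 0 convpsi psi1 lpsi.
  rewrite lexx ltr01 /slope1 subr0 divr1 => /(_ isT); lra.
- exact: addr_ge0.
- move=> x /andP[x0]; rewrite le_eqVlt => /predU1P[->|x1]; first by rewrite phi1.
  have := @slope1_noninc R _ 0 x convphi nphi1.
  rewrite lexx x0 x1 => /(_ isT isT); rewrite !slopeN.
  by rewrite lerN2 {1}/slope1 phi0 mul0r /slope1 ler_pdivlMr ?subr_gt0// mul0r.
- move=> x y xy y1.
  have := convex_increment_le convphi nphi1 lnphi xy y1; lra.
- move=> x y xy y1.
  have := convex_increment_le convpsi psi1 lpsi xy y1; lra.
- move=> x /andP[x0]; rewrite le_eqVlt => /predU1P[->|x1].
    by rewrite psi1 subrr mulr0.
  have := @slope1_noninc R _ 0 x convpsi psi1.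
  rewrite lexx x0 x1 => /(_ isT isT); rewrite {2}/slope1 subr0 divr1.
  by rewrite /slope1 ler_pdivrMr ?subr_gt0.
- move=> x y xy y1; have := slope1_noninc convphi nphi1 xy y1.
  by rewrite !slopeN lerN2.
- by move=> x y xy y1; exact: slope1_noninc convpsi psi1 xy y1.
- move=> x y xy y1; have [+ _] := HL x => /(_ y xy y1); rewrite !slopeN.
  have : 0 <= L' * (y - x) by rewrite mulr_ge0// subr_ge0; case/andP: xy.
  lra.
- move=> x y xy y1; have [+ _] := HL' x => /(_ y xy y1).
  have : 0 <= L * (y - x) by rewrite mulr_ge0// subr_ge0; case/andP: xy.
  lra.
- move=> x x01; have [_ +] := HL x => /(_ x01); rewrite slopeN.
  have : 0 <= L' * (1 - x) by rewrite mulr_ge0// subr_ge0 ltW//; case/andP: x01.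
  lra.
- move=> x x01; have [_ +] := HL' x => /(_ x01).
  have : 0 <= L * (1 - x) by rewrite mulr_ge0// subr_ge0 ltW//; case/andP: x01.
  lra.
Qed.

(** * Characteristics *)

Lemma is_derive_right_slope (R : realType) (f : R -> R) (x d e : R) :
  is_derive x (1 : R) f d -> 0 < e ->
  \forall z \near x^'+, f z - f x <= (d + e) * (z - x).
Proof.
move=> [df dE] e0.
have cv : h^-1 *: ((f \o shift x) (h *: (1 : R)) - f x) @[h --> (0 : R)^'] --> d.
  by rewrite -dE; exact: df.
have : \forall h \near (0 : R)^', h^-1 *: ((f \o shift x) (h *: (1 : R)) - f x) < d + e.
  by apply: (cvgr_lt _ cv); rewrite ltrDl.
move=> [r /= r0 Hr]; exists r => //= z; rewrite /ball_/= => zr xz.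
have zx0 : 0 < z - x by rewrite subr_gt0.
have := Hr (z - x); rewrite /ball_/= sub0r normrN distrC => /(_ zr).
rewrite gt_eqF// => /(_ isT).
rewrite /GRing.scale/= mulr1 subrK mulrC ltr_pdivrMr// => /ltW.
exact.
Qed.

Lemma characteristic_restrict (R : realType) (phi psi kappa : R -> R)
    (x t s : R) (X : R -> R) :
  characteristic phi psi kappa x t X -> 0 <= s <= t ->
  characteristic phi psi kappa (X s) s X.
Proof.
move=> [X01 cX dX Xt] /andP[s0 st]; split=> //.
- by move=> r /andP[r0 rs]; apply: X01; rewrite r0 (le_trans rs).
- by apply: continuous_subspaceW cX; apply: subset_itvl; rewrite bnd_simp.
- by move=> r /andP[r0 rs]; apply: dX; rewrite r0 (lt_le_trans rs).
Qed.

(* The drift may fail to be one-sided Lipschitz forward in time, as the slope of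
   phi at 0 may be infinite; backward in time it is, by concavity, and
   min(e^(A r) (Y r - X r), 0) is nonincreasing in r. *)
Lemma characteristic_mono (R : realType) (phi psi kappa : R -> R)
    (al A B L x y t : R) (X Y : R -> R) :
  drift_bounds phi psi al A B L -> (forall s, 0 <= s -> 0 < kappa s) ->
  characteristic phi psi kappa x t X -> characteristic phi psi kappa y t Y ->
  x <= y -> forall s, 0 <= s <= t -> X s <= Y s.
Proof.
move=> db kp [X01 cX dX Xt] [Y01 cY dY Yt] xy s /andP[s0 st].
rewrite leNgt; apply/negP => YX.
pose E r := expR (A * r) * (Y r - X r).
pose f r := Num.min (E r) 0.
have sub : `[s, t] `<=` `[0, t] by apply: subset_itvr; rewrite bnd_simp.
have cE : {within `[s, t], continuous E}.
  have cX' := continuous_subspaceW sub cX; have cY' := continuous_subspaceW sub cY.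
  by rewrite /E; cont.
have cf : {within `[s, t], continuous f}.
  by move=> r; apply: continuous_min; [exact: cE|exact: cvg_cst].
have : f t <= f s.
  apply: right_slope_le0 => // e r e0 /andP[sr rt].
  have r0 := le_lt_trans s0 sr; have r0t : 0 < r < t by rewrite r0.
  (* Where [E r] is nonnegative, [f r] is 0, the largest value [f] can take, so no increment is
     positive. Where it is negative, [f] agrees with [E] at r and lies below [E] afterwards. The
     corner of the minimum is why right slopes are used. *)
  have [Er|Er] := ltP (E r) 0; last first.
    near=> z.
      rewrite /f (min_idPr Er) subr0; apply: (@le_trans _ _ 0).
        by rewrite ge_min lexx orbT.
      by rewrite mulr_ge0 ?(ltW e0)// subr_ge0; near: z; exact: nbhs_right_ge.
  have dXr := dX r r0t; have dYr := dY r r0t.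
  have dE : is_derive r (1 : R) E (expR (A * r) * (A * (Y r - X r) +
     ((phi (Y r) - kappa r * psi (Y r)) - (phi (X r) - kappa r * psi (X r))))).
    by rewrite /E; der_eq; rewrite /=; ring.
  have near1 := is_derive_right_slope dE e0.
  near=> z.
  have rz : r < z by near: z; exact: nbhs_right_gt.
  apply: (@le_trans _ _ (E z - E r)).
    by apply: lerB; rewrite /f ?ge_min ?lexx// (min_idPl (ltW Er)).
  apply: (le_trans (_ : _ <= (_ + e) * (z - r))); first by near: z; exact: near1.
  rewrite ler_wpM2r ?subr_ge0 ?(ltW rz)// gerDr pmulr_rle0 ?expR_gt0//.
  have Dr : Y r < X r.
    by move: Er; rewrite /E pmulr_rlt0 ?expR_gt0// subr_lt0.
  have r0t' : 0 <= r <= t by rewrite !ltW.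
  have /andP[Xr0 Xr1] := X01 r r0t'; have /andP[Yr0 Yr1] := Y01 r r0t'.
  have := db_phi_incr db (_ : 0 <= Y r <= X r) Xr1.
  have := db_psi_incr db (_ : 0 <= Y r <= X r) Xr1.
  rewrite Yr0 (ltW Dr) => /(_ isT) H1 /(_ isT) H2.
  have k0 := kp r (ltW r0).
  have : 0 <= kappa r * (psi (Y r) - psi (X r)).
    apply: mulr_ge0; first exact: ltW.
    have : 0 <= al * (X r - Y r) by rewrite mulr_ge0 ?subr_ge0 ?(ltW Dr)// ltW// (db_al db).
    lra.
  lra.
rewrite /f /E Xt Yt (min_idPr _); last by rewrite mulr_ge0 ?expR_ge0// subr_ge0.
rewrite le_min lexx andbT pmulr_rge0 ?expR_gt0// subr_ge0.
by rewrite leNgt YX.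
Unshelve. all: by end_near. Qed.

Lemma within_ray_segment (R : realType) (kappa : R -> R) (t : R) :
  {within `[0, +oo[%classic, continuous kappa} ->
  {within `[0, t], continuous kappa}.
Proof.
move=> ck; apply: continuous_subspaceW ck => s /=.
by rewrite !in_itv/= andbT => /andP[].
Qed.

(** With K the maximum of kappa on [0, t], the gap satisfies (1 - X)' <= K B (1 - X), so by Gronwall
    a gap that is zero at time s would still be zero at time t. This makes logarithms of gaps
    meaningful. *)
Lemma characteristic_lt1 (R : realType) (phi psi kappa : R -> R)
    (al A B L x t : R) (X : R -> R) :
  drift_bounds phi psi al A B L -> {within `[0, +oo[%classic, continuous kappa} ->
  (forall s, 0 <= s -> 0 < kappa s) ->
  characteristic phi psi kappa x t X -> x < 1 ->
  forall s, 0 <= s <= t -> X s < 1.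
Proof.
move=> db ck kp [X01 cX dX Xt] x1 s /andP[s0 st].
have t0 := le_trans s0 st.
have [c _ Hc] := EVT_max t0 (within_ray_segment (t := t) ck).
pose K := kappa c.
pose f r := (1 - X r) * expR (- (K * B * r)).
have sub : `[s, t] `<=` `[0, t] by apply: subset_itvr; rewrite bnd_simp.
have cf : {within `[s, t], continuous f}.
  by have cX' := continuous_subspaceW sub cX; rewrite /f; cont.
have : f t <= f s.
  apply: (@derive_le0_le R f (fun r => expR (- (K * B * r)) *
    ((kappa r * psi (X r) - phi (X r)) - K * B * (1 - X r)))) => //.
    move=> r /andP[sr rt]; have r0 := le_lt_trans s0 sr.
    have dXr := dX r; rewrite r0 rt in dXr; have {}dXr := dXr isT.
    by rewrite /f; der_eq; rewrite /=; ring.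
  move=> r /andP[sr rt]; have r0 := le_lt_trans s0 sr.
  have r0t : 0 <= r <= t by rewrite !ltW.
  rewrite pmulr_rle0 ?expR_gt0//.
  have /andP[Xr0 Xr1] := X01 r r0t.
  have P := db_phi_ge0 db (X01 r r0t).
  have Q := db_psi_le db (X01 r r0t).
  have kr := kp r (ltW r0).
  have kK : kappa r <= K by apply: Hc; rewrite in_itv.
  have Q1 : kappa r * psi (X r) <= kappa r * (B * (1 - X r)).
    by rewrite ler_wpM2l// ltW.
  have Q2 : kappa r * (B * (1 - X r)) <= K * (B * (1 - X r)).
    by rewrite ler_wpM2r// mulr_ge0 ?subr_ge0// (db_B db).
  lra.
rewrite /f Xt => H; rewrite -subr_gt0 -(pmulr_lgt0 _ (expR_gt0 (- (K * B * s)))).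
by apply: lt_le_trans H; rewrite mulr_gt0 ?expR_gt0 ?subr_gt0.
Qed.

(** The term kappa psi is nonnegative and phi(X) <= A (1 - X), so (1 - X)' >= -A (1 - X). The
    resulting backward growth bound does not involve kappa. *)
Lemma characteristic_gap_le (R : realType) (phi psi kappa : R -> R)
    (al A B L x t : R) (X : R -> R) :
  drift_bounds phi psi al A B L -> (forall s, 0 <= s -> 0 < kappa s) ->
  characteristic phi psi kappa x t X -> forall s, 0 <= s <= t ->
  1 - X s <= expR (A * (t - s)) * (1 - x).
Proof.
move=> db kp [X01 cX dX Xt] s /andP[s0 st].
pose f r := - ((1 - X r) * expR (A * r)).
have sub : `[s, t] `<=` `[0, t] by apply: subset_itvr; rewrite bnd_simp.
have cf : {within `[s, t], continuous f}.
  by have cX' := continuous_subspaceW sub cX; rewrite /f; cont.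
have : f t <= f s.
  apply: (@derive_le0_le R f (fun r => - (expR (A * r) *
    ((kappa r * psi (X r) - phi (X r)) + A * (1 - X r))))) => //.
    move=> r /andP[sr rt]; have r0 := le_lt_trans s0 sr.
    have dXr := dX r; rewrite r0 rt in dXr; have {}dXr := dXr isT.
    by rewrite /f; der_eq; rewrite /=; ring.
  move=> r /andP[sr rt]; have r0 := le_lt_trans s0 sr.
  have r0t : 0 <= r <= t by rewrite !ltW.
  rewrite oppr_le0 pmulr_rge0 ?expR_gt0//.
  have /andP[Xr0 Xr1] := X01 r r0t.
  have P := db_phi_incr db (X01 r r0t) (lexx 1).
  have Q := db_psi_incr db (X01 r r0t) (lexx 1).
  rewrite (db_phi1 db) in P; rewrite (db_psi1 db) in Q.
  have : 0 <= kappa r * psi (X r).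
    apply: mulr_ge0; first exact/ltW/kp/ltW.
    have : 0 <= al * (1 - X r) by rewrite mulr_ge0 ?subr_ge0// ltW// (db_al db).
    lra.
  lra.
rewrite /f Xt lerN2 => H.
rewrite -(ler_pM2r (expR_gt0 (A * s))) mulrAC -expRD -mulrDr subrK.
by rewrite [leRHS]mulrC.
Qed.

Lemma characteristic_ln_derive (R : realType) (phi psi kappa : R -> R)
    (x t s : R) (X : R -> R) :
  characteristic phi psi kappa x t X -> 0 < s < t -> X s < 1 ->
  is_derive s (1 : R) (fun r => ln (1 - X r))
    (kappa s * slope1 psi (X s) - slope1 phi (X s)).
Proof.
move=> [X01 cX dX Xt] s0t Xs1; have dXs := dX s s0t.
have p : 0 < 1 - X s by rewrite subr_gt0.
by der_eq; rewrite //= /slope1; field; rewrite gt_eqF.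
Qed.

Lemma characteristic_ln_continuous (R : realType) (phi psi kappa : R -> R)
    (x t : R) (X : R -> R) :
  characteristic phi psi kappa x t X -> (forall s, 0 <= s <= t -> X s < 1) ->
  {within `[0, t], continuous (fun r => ln (1 - X r))}.
Proof.
move=> [X01 cX dX Xt] X1; apply: within_continuous_ln; last by cont.
by move=> s /=; rewrite in_itv/= subr_gt0 => /X1.
Qed.

(** Convexity of the backward flow, in the form needed below: its chords ending at 1 become steeper
    as their left end moves towards 1. The difference of the logarithmic gaps has the sign of its
    derivative from the monotone chord slopes and kappa > 0. *)
Lemma characteristic_ln_ratio (R : realType) (phi psi kappa : R -> R)
    (al A B L x y t : R) (X Y : R -> R) :
  drift_bounds phi psi al A B L -> {within `[0, +oo[%classic, continuous kappa} ->
  (forall s, 0 <= s -> 0 < kappa s) ->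
  characteristic phi psi kappa x t X -> characteristic phi psi kappa y t Y ->
  x <= y -> y < 1 -> forall s, 0 <= s <= t ->
  ln (1 - y) - ln (1 - x) <= ln (1 - Y s) - ln (1 - X s).
Proof.
move=> db ck kp hX hY xy y1 s /andP[s0 st].
have X1 := characteristic_lt1 db ck kp hX (le_lt_trans xy y1).
have Y1 := characteristic_lt1 db ck kp hY y1.
have XY := characteristic_mono db kp hX hY xy.
have sub : `[s, t] `<=` `[0, t] by apply: subset_itvr; rewrite bnd_simp.
have cX := continuous_subspaceW sub (characteristic_ln_continuous hX X1).
have cY := continuous_subspaceW sub (characteristic_ln_continuous hY Y1).
have := @derive_le0_le R (fun r => ln (1 - Y r) - ln (1 - X r))
  (fun r => (kappa r * slope1 psi (Y r) - slope1 phi (Y r)) -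
            (kappa r * slope1 psi (X r) - slope1 phi (X r))) s t st.
move/(_ (within_continuousB cY cX)).
have [_ _ _ ->] := hX; have [_ _ _ ->] := hY; apply.
  move=> r /andP[sr rt]; have r0 := le_lt_trans s0 sr.
  have r0t : 0 < r < t by rewrite r0.
  have r0t' : 0 <= r <= t by rewrite !ltW.
  apply: is_derive_subf.
    exact: characteristic_ln_derive hY r0t (Y1 r r0t').
  exact: characteristic_ln_derive hX r0t (X1 r r0t').
move=> r /andP[sr rt]; have r0 := le_lt_trans s0 sr.
have r0t' : 0 <= r <= t by rewrite !ltW.
have [/(_ r r0t')/andP[Xr0 _] _ _ _] := hX.
have XYr : 0 <= X r <= Y r by rewrite Xr0 XY.
have := db_phi_slope db XYr (Y1 r r0t').
have : kappa r * slope1 psi (Y r) <= kappa r * slope1 psi (X r).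
  by rewrite ler_wpM2l ?(ltW (kp r _)) ?(ltW r0)// (db_psi_slope db XYr (Y1 r r0t')).
lra.
Qed.

(* [E] bounds the integral of (1 + kappa)(1 - X): psi(X) >= al (1 - X) turns
   kappa (1 - X) into at most ((1 - X)' + A (1 - X)) / al. *)
Lemma characteristic_budget (R : realType) (phi psi kappa : R -> R)
    (al A B L x t C mu : R) (X : R -> R) :
  drift_bounds phi psi al A B L -> (forall s, 0 <= s -> 0 < kappa s) ->
  characteristic phi psi kappa x t X -> 0 <= C -> 0 < mu ->
  (forall s, 0 <= s <= t -> 1 - X s <= C * expR (- (mu * (t - s)))) ->
  exists E E' : R -> R, [/\ {within `[0, t], continuous E},
    forall s, 0 < s < t -> is_derive s (1 : R) E (E' s),
    forall s, 0 < s < t -> (1 + kappa s) * (1 - X s) <= E' s &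
    forall s, 0 <= s <= t -> 0 <= E s <= al^-1 + (A / al + 1) * C / mu].
Proof.
move=> db kp [X01 cX dX Xt] C0 mu0 HX.
have al0 := db_al db; have A0 := db_A db.
have D0 : 0 <= A / al + 1 by rewrite addr_ge0 ?divr_ge0 ?(ltW al0).
(* The exponential term is a primitive of (A/al + 1) C e^{-mu (t - s)}, which dominates (A/al + 1)(1
   - X): the share A/al undoes the contribution of phi, and the share 1 covers the part of (1 +
   kappa)(1 - X) without kappa. *)
pose E s := (1 - X s) * al^-1 +
  ((A / al + 1) * C / mu) * expR (mu * s - mu * t).
pose E' s := (kappa s * psi (X s) - phi (X s)) / al +
  (A / al + 1) * C * expR (mu * s - mu * t).
exists E, E'; split.
- by rewrite /E; cont.
- move=> s s0t; have dXs := dX s s0t.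
  by rewrite /E /E'; der_eq; rewrite /=; field; rewrite !gt_eqF.
- move=> s /andP[s0 st]; have s0t : 0 <= s <= t by rewrite !ltW.
  have /andP[Xs0 Xs1] := X01 s s0t.
  have := HX s s0t; rewrite (_ : - (mu * (t - s)) = mu * s - mu * t); last by ring.
  move=> H; have P := db_phi_incr db (X01 s s0t) (lexx 1).
  have Q := db_psi_incr db (X01 s s0t) (lexx 1).
  rewrite (db_phi1 db) in P; rewrite (db_psi1 db) in Q.
  have H1 : (A / al + 1) * (1 - X s) <= (A / al + 1) * (C * expR (mu * s - mu * t)).
    by rewrite ler_wpM2l.
  have H2 : kappa s * (al * (1 - X s)) <= kappa s * psi (X s).
    by rewrite ler_wpM2l ?(ltW (kp s _)) ?(ltW s0)//; lra.
  have H3 : (kappa s * (al * (1 - X s)) - A * (1 - X s)) / al <=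
     (kappa s * psi (X s) - phi (X s)) / al.
    by rewrite ler_wpM2r ?invr_ge0 ?(ltW al0)//; lra.
  have E3 : (kappa s * (al * (1 - X s)) - A * (1 - X s)) / al =
     kappa s * (1 - X s) - A / al * (1 - X s).
    by field; rewrite gt_eqF.
  rewrite E3 in H3; rewrite /E' -mulrA; lra.
- move=> s s0t; have /andP[Xs0 Xs1] := X01 s s0t.
  have M0 : 0 <= (A / al + 1) * C / mu by rewrite divr_ge0 ?(ltW mu0)// mulr_ge0.
  rewrite /E addr_ge0 ?mulr_ge0 ?subr_ge0 ?expR_ge0 ?invr_ge0 ?(ltW al0) ?(ltW mu0)//=.
  apply: lerD.
    by rewrite ler_piMl ?invr_ge0 ?(ltW al0)//; lra.
  rewrite ler_piMr// -expR0 ler_expR subr_le0 ler_pM2l//.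
  by case/andP: s0t.
Qed.

(** Converse to the monotonicity of gap quotients: traced back to time 0, the quotient may approach
    1, but its excess over 1 shrinks at most by a factor that is independent of t as soon as the
    budget [M] is. *)
Lemma characteristic_spread (R : realType) (phi psi kappa : R -> R)
    (al A B L x z t M : R) (X Z E E' : R -> R) :
  drift_bounds phi psi al A B L -> {within `[0, +oo[%classic, continuous kappa} ->
  (forall s, 0 <= s -> 0 < kappa s) -> 0 <= t ->
  characteristic phi psi kappa x t X -> characteristic phi psi kappa z t Z ->
  x <= z -> z < 1 -> (forall s, 0 <= s <= t -> 1 / 2 <= X s) ->
  {within `[0, t], continuous E} ->
  (forall s, 0 < s < t -> is_derive s (1 : R) E (E' s)) ->
  (forall s, 0 < s < t -> (1 + kappa s) * (1 - X s) <= E' s) ->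
  (forall s, 0 <= s <= t -> 0 <= E s <= M) ->
  ((1 - x) / (1 - z) - 1) * expR (- (L * M)) <= (1 - X 0) / (1 - Z 0) - 1.
Proof.
move=> db ck kp t0 hX hZ xz z1 X2 cE dE bE HM.
have X1 := characteristic_lt1 db ck kp hX (le_lt_trans xz z1).
have Z1 := characteristic_lt1 db ck kp hZ z1.
have XZ := characteristic_mono db kp hX hZ xz.
have cX := characteristic_ln_continuous hX X1.
have cZ := characteristic_ln_continuous hZ Z1.
have L0 := db_L db.
have H00 : (0 : R) <= 0 <= t by rewrite lexx.
have Htt : 0 <= t <= t by rewrite lexx t0.
(* the relative spread R = (1 - X) / (1 - Z) - 1 satisfies R' <= L E' R *)
pose rho r := ln (1 - X r) - ln (1 - Z r).
pose f r := (expR (rho r) - 1) * expR (- (L * E r)).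
have rhoE r : 0 <= r <= t -> expR (rho r) = (1 - X r) / (1 - Z r).
  move=> r0t; rewrite /rho -ln_div ?posrE ?subr_gt0 ?X1 ?Z1//.
  by rewrite lnK// posrE divr_gt0// subr_gt0 ?X1 ?Z1.
have rho_ge1 r : 0 <= r <= t -> 1 <= expR (rho r).
  move=> r0t; rewrite rhoE// ler_pdivlMr ?subr_gt0 ?Z1// mul1r lerD2l lerN2.
  exact: XZ.
have : f t <= f 0.
  apply: (@derive_le0_le R f (fun r => expR (- (L * E r)) * (expR (rho r) *
    ((kappa r * slope1 psi (X r) - slope1 phi (X r)) -
     (kappa r * slope1 psi (Z r) - slope1 phi (Z r))) -
     (expR (rho r) - 1) * L * E' r))) => //.
  - have crho := within_continuousB cX cZ.
    by rewrite /f; cont.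
  - move=> r r0t; have r0t' : 0 <= r <= t by case/andP: r0t => *; rewrite !ltW.
    have dX := characteristic_ln_derive hX r0t (X1 r r0t').
    have dZ := characteristic_ln_derive hZ r0t (Z1 r r0t').
    have drho := is_derive_subf dX dZ; rewrite -/rho in drho.
    have dEr := dE r r0t.
    by rewrite /f; der_eq; rewrite /=; ring.
  - move=> r r0t; have r0t' : 0 <= r <= t by case/andP: r0t => *; rewrite !ltW.
    have r0 : 0 <= r by case/andP: r0t'.
    rewrite pmulr_rle0 ?expR_gt0//.
    have XZr : 1 / 2 <= X r <= Z r by rewrite X2// XZ.
    have P := db_phi_lip db XZr (Z1 r r0t').
    have Q := db_psi_lip db XZr (Z1 r r0t').
    have kQ : kappa r * (slope1 psi (X r) - slope1 psi (Z r)) <=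
        kappa r * (L * (Z r - X r)).
      by rewrite ler_wpM2l// ltW// kp.
    have S : (kappa r * slope1 psi (X r) - slope1 phi (X r)) -
     (kappa r * slope1 psi (Z r) - slope1 phi (Z r)) <= L * (1 + kappa r) * (Z r - X r) by lra.
    have S1 : expR (rho r) * ((kappa r * slope1 psi (X r) - slope1 phi (X r)) -
     (kappa r * slope1 psi (Z r) - slope1 phi (Z r))) <=
       expR (rho r) * (L * (1 + kappa r) * (Z r - X r)).
      by rewrite ler_pM2l ?expR_gt0.
    (* With e^rho = (1 - X)/(1 - Z) one has e^rho (Z - X) = (e^rho - 1)(1 - X): this produces both
       the spread itself and the factor 1 - X that the budget integrates. *)
    have S2 : expR (rho r) * (L * (1 + kappa r) * (Z r - X r)) =
      (expR (rho r) - 1) * L * ((1 + kappa r) * (1 - X r)).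
      rewrite rhoE//; field; rewrite gt_eqF// subr_gt0; exact: Z1.
    have S3 : (expR (rho r) - 1) * L * ((1 + kappa r) * (1 - X r)) <=
       (expR (rho r) - 1) * L * E' r.
      by rewrite ler_wpM2l ?mulr_ge0 ?subr_ge0 ?rho_ge1// bE.
    lra.
rewrite /f !rhoE//; have [_ _ _ ->] := hX; have [_ _ _ ->] := hZ => H.
have /andP[E00 _] := HM 0 H00; have /andP[_ EtM] := HM t Htt.
have q0 : 0 <= (1 - X 0) / (1 - Z 0) - 1 by rewrite -rhoE// subr_ge0 rho_ge1.
have p0 : 0 <= (1 - x) / (1 - z) - 1.
  by rewrite subr_ge0 ler_pdivlMr ?subr_gt0// mul1r lerD2l lerN2.
apply: (@le_trans _ _ (((1 - x) / (1 - z) - 1) * expR (- (L * E t)))).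
  by rewrite ler_wpM2l// ler_expR lerN2 ler_wpM2l.
apply: (le_trans H); rewrite ler_piMr// -expR0 ler_expR oppr_le0.
by rewrite mulr_ge0.
Qed.

(** * The initial profile near 1 *)

Lemma initial_profile_continuous (R : realType) (c0 : R -> R) :
  initial_density c0 -> {within `[0, 1], continuous (tail_integral c0)}.
Proof. by case=> _ ic0 _ _; exact: tail_integral_continuous. Qed.

Lemma initial_profile_noninc (R : realType) (c0 : R -> R) (x y : R) :
  initial_density c0 -> 0 <= x <= y -> y <= 1 ->
  tail_integral c0 y <= tail_integral c0 x.
Proof.
move=> [c0_ge0 ic0 _ _] xy y1; rewrite -subr_ge0 -(mul0r (y - x)).
apply: tail_integralB_ge => // z /andP[xz zy]; apply: c0_ge0.
by case/andP: xy => x0 xy; rewrite (le_trans x0 xz) (lt_le_trans zy y1).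
Qed.

Lemma initial_profile_gt0 (R : realType) (c0 : R -> R) (x : R) :
  initial_density c0 -> 0 <= x < 1 -> 0 < tail_integral c0 x.
Proof. by case=> _ _ + _ => /[apply]. Qed.

Lemma initial_profile_integrable (R : realType) (c0 : R -> R) :
  initial_density c0 ->
  lebesgue_measure.-integrable `[0%R, 1%R[ (EFin \o tail_integral c0).
Proof. by move=> /initial_profile_continuous; exact: within_continuous_integrable. Qed.

Lemma initial_tail_le (R : realType) (c0 : R -> R) (x y : R) :
  initial_density c0 -> 0 <= x <= y -> y <= 1 ->
  tail_integral (tail_integral c0) x - tail_integral (tail_integral c0) y <=
    tail_integral c0 x * (y - x).
Proof.
move=> hi /andP[x0 xy] y1; apply: tail_integralB_le => //.
- exact: initial_profile_integrable.
- by rewrite x0.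
- move=> z /andP[xz zy]; apply: initial_profile_noninc => //; first by rewrite x0.
  exact: le_trans (ltW zy) y1.
Qed.

Lemma initial_tail_ge (R : realType) (c0 : R -> R) (x y : R) :
  initial_density c0 -> 0 <= x <= y -> y <= 1 ->
  tail_integral c0 y * (y - x) <=
  tail_integral (tail_integral c0) x - tail_integral (tail_integral c0) y.
Proof.
move=> hi /andP[x0 xy] y1; apply: tail_integralB_ge => //.
- exact: initial_profile_integrable.
- by rewrite x0.
- move=> z /andP[xz zy]; apply: initial_profile_noninc => //.
  by rewrite (le_trans x0 xz) ltW.
Qed.

Lemma initial_tail_gt0 (R : realType) (c0 : R -> R) (x : R) :
  initial_density c0 -> 0 <= x < 1 -> 0 < tail_integral (tail_integral c0) x.
Proof.
move=> hi /andP[x0 x1]; pose m := (x + 1) / 2.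
have xm : x < m by rewrite /m; lra.
have m1 : m < 1 by rewrite /m; lra.
have := initial_tail_ge hi (_ : 0 <= x <= m) (ltW m1).
rewrite x0 (ltW xm) => /(_ isT).
have : 0 < tail_integral c0 m * (m - x).
  rewrite mulr_gt0 ?subr_gt0//; apply: initial_profile_gt0 => //.
  by rewrite m1 (le_trans x0) ?(ltW xm).
have := initial_tail_ge hi (_ : 0 <= m <= 1) (lexx 1).
rewrite (le_trans x0 (ltW xm)) (ltW m1) => /(_ isT).
by rewrite !tail_integral1 mul0r subr0; lra.
Qed.

Lemma initial_tail_noninc (R : realType) (c0 : R -> R) (x y : R) :
  initial_density c0 -> 0 <= x <= y -> y < 1 ->
  tail_integral (tail_integral c0) y <= tail_integral (tail_integral c0) x.
Proof.
move=> hi /andP[x0 xy] y1; rewrite -subr_ge0.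
apply: le_trans (initial_tail_ge hi _ (ltW y1)); last by rewrite x0.
apply: mulr_ge0; last by rewrite subr_ge0.
by apply/ltW/initial_profile_gt0 => //; rewrite y1 (le_trans x0).
Qed.

Lemma initial_profile_right (R : realType) (c0 : R -> R) (x : R) :
  initial_density c0 -> 0 <= x < 1 ->
  tail_integral c0 z @[z --> x^'+] --> tail_integral c0 x.
Proof.
by move=> hi; apply: within_continuous_right; exact: initial_profile_continuous.
Qed.

Lemma initial_tail_right (R : realType) (c0 : R -> R) (x : R) :
  initial_density c0 -> 0 <= x < 1 ->
  tail_integral (tail_integral c0) z @[z --> x^'+] -->
  tail_integral (tail_integral c0) x.
Proof.
move=> hi; apply: within_continuous_right; apply: tail_integral_continuous.
exact: initial_profile_integrable.
Qed.

(** Pointwise c = beta w^2/h, and on [y, z[ the monotonicity of w and h replaces w by its value at y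
    and h by its value at z. Integrating gives a finite-increment substitute for a bound on w'. *)
Lemma density_le (R : realType) (c0 : R -> R) (B y z : R) :
  initial_density c0 -> 0 <= y <= z -> z < 1 -> 0 <= B ->
  (forall x, y <= x < 1 -> beta c0 (tail_integral c0) x <= B) ->
  tail_integral c0 y - tail_integral c0 z <=
  B * tail_integral c0 y ^+ 2 / tail_integral (tail_integral c0) z * (z - y).
Proof.
move=> hi /andP[y0 yz] z1 B0 HB.
have ic0 : lebesgue_measure.-integrable `[0%R, 1%R[ (EFin \o c0) by case: hi.
apply: tail_integralB_le => //; [by rewrite y0|exact: ltW|].
move=> x /andP[yx xz]; have x1 := lt_trans xz z1.
have x0 := le_trans y0 yx.
have wx : 0 < tail_integral c0 x by apply: initial_profile_gt0; rewrite ?x0.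
have hx : 0 < tail_integral (tail_integral c0) x by apply: initial_tail_gt0; rewrite ?x0.
have hz : 0 < tail_integral (tail_integral c0) z.
  by apply: initial_tail_gt0 => //; rewrite (le_trans y0).
have := HB x; rewrite yx x1 => /(_ isT); rewrite /beta.
rewrite ler_pdivrMr ?exprn_gt0// -ler_pdivlMr// => /le_trans; apply.
apply: ler_pM.
- by rewrite mulr_ge0// exprn_ge0// ltW.
- by rewrite invr_ge0 ltW.
- rewrite ler_wpM2l// lerXn2r ?nnegrE ?(ltW wx)//.
    by apply/ltW/initial_profile_gt0 => //; rewrite y0 (le_lt_trans yx).
  by apply: initial_profile_noninc; rewrite ?y0 ?yx ?(ltW x1).
- rewrite lef_pV2// ?posrE//.
  by apply: initial_tail_noninc; rewrite // ?x0 ?(ltW xz).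
Qed.

Lemma density_ge (R : realType) (c0 : R -> R) (B y z : R) :
  initial_density c0 -> 0 <= y <= z -> z < 1 -> 0 <= B ->
  (forall x, y <= x < 1 -> B <= beta c0 (tail_integral c0) x) ->
  B * tail_integral c0 z ^+ 2 / tail_integral (tail_integral c0) y * (z - y) <=
  tail_integral c0 y - tail_integral c0 z.
Proof.
move=> hi /andP[y0 yz] z1 B0 HB.
have ic0 : lebesgue_measure.-integrable `[0%R, 1%R[ (EFin \o c0) by case: hi.
apply: tail_integralB_ge => //; [by rewrite y0|exact: ltW|].
move=> x /andP[yx xz]; have x1 := lt_trans xz z1.
have x0 := le_trans y0 yx.
have wx : 0 < tail_integral c0 x by apply: initial_profile_gt0; rewrite ?x0.
have hx : 0 < tail_integral (tail_integral c0) x by apply: initial_tail_gt0; rewrite ?x0.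
have hy : 0 < tail_integral (tail_integral c0) y.
  by apply: initial_tail_gt0 => //; rewrite y0 (le_lt_trans yx).
have wz : 0 < tail_integral c0 z.
  by apply: initial_profile_gt0 => //; rewrite (le_trans y0 yz).
have := HB x; rewrite yx x1 => /(_ isT); rewrite /beta.
rewrite ler_pdivlMr ?exprn_gt0// -ler_pdivrMr//; apply: le_trans.
apply: ler_pM.
- by rewrite mulr_ge0// exprn_ge0// ltW.
- by rewrite invr_ge0 ltW.
- rewrite ler_wpM2l// lerXn2r ?nnegrE ?(ltW wx) ?(ltW wz)//.
  by apply: initial_profile_noninc; rewrite ?x0 ?(ltW xz) ?(ltW z1).
- rewrite lef_pV2// ?posrE//.
  by apply: initial_tail_noninc; rewrite // ?y0 ?yx.
Qed.

Lemma initial_ratio_continuous (R : realType) (c0 : R -> R) (y b : R) :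
  initial_density c0 -> 0 <= y -> b < 1 ->
  {within `[y, b], continuous
    (fun x => tail_integral (tail_integral c0) x / tail_integral c0 x)}.
Proof.
move=> hi y0 b1.
have sub : `[y, b] `<=` `[0, 1] by apply: subset_itv; rewrite bnd_simp// ltW.
have cw := initial_profile_continuous hi.
have ch := tail_integral_continuous (initial_profile_integrable hi).
apply: within_continuousM; first exact: continuous_subspaceW ch.
move=> x; apply: (@continuous_within_comp _ _ _ (fun u => u^-1)).
  exact: continuous_subspaceW cw.
move=> {}x /=; rewrite in_itv/= => /andP[yx xb].
apply: inv_continuous; rewrite gt_eqF//; apply: initial_profile_gt0 => //.
by rewrite (le_trans y0 yx) (le_lt_trans xb).
Qed.

(** Formally (h/w)' = beta - 1 <= B - 1; integrating from y to b, discarding the nonnegative value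
    at b and letting b tend to 1 gives the claim. The slack e absorbs the error of the right
    slopes. *)
Lemma initial_tail_lower (R : realType) (c0 : R -> R) (B y : R) :
  initial_density c0 -> 0 <= y < 1 -> 0 <= B ->
  (forall x, y <= x < 1 -> beta c0 (tail_integral c0) x <= B) ->
  (1 - B) * (1 - y) * tail_integral c0 y <= tail_integral (tail_integral c0) y.
Proof.
move=> hi /andP[y0 y1] B0 HB.
set w := tail_integral c0; set h := tail_integral w.
have wp x : 0 <= x < 1 -> 0 < w x by exact: initial_profile_gt0.
have hp x : 0 <= x < 1 -> 0 < h x by exact: initial_tail_gt0.
rewrite -ler_pdivlMr; last by apply: wp; rewrite y0.
suff H e : 0 < e -> (1 - B - e) * (1 - y) <= h y / w y.
  apply/ler_addgt0Pr => e e0; have := H (e / (1 - y)).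
  rewrite divr_gt0 ?subr_gt0// => /(_ isT).
  by rewrite mulrBl divfK ?gt_eqF ?subr_gt0// lerBlDr.
move=> e0.
have cv : (1 - B - e) * (b - y) @[b --> 1^'-] --> (1 - B - e) * (1 - y).
  apply: cvgM; first exact: cvg_cst.
  by apply: cvgB; [exact/cvg_at_left_filter/cvg_id|exact: cvg_cst].
apply: (at_left_lim_le y1 cv) => b /andP[yb b1].
have := @right_slope_le R (fun x => h x / w x) y b (B + e - 1) (ltW yb).
move/(_ (initial_ratio_continuous hi y0 b1)) => Hs.
suff : h b / w b - h y / w y <= (B + e - 1) * (b - y).
  have : 0 <= h b / w b.
    by rewrite divr_ge0// ltW ?hp ?wp// b1 (le_trans y0 (ltW yb)).
  by rewrite (_ : B + e - 1 = - (1 - B - e)) ?mulNr; [lra|ring].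
apply: Hs => x /andP[yx xb]; have x0 := le_trans y0 yx.
have x1 := lt_trans xb b1.
have wx := wp x; have hx := hp x; rewrite x0 x1 in wx hx.
have {}wx := wx isT; have {}hx := hx isT.
(* The increment estimate carries values at both x and z; the quotient that records the mismatch
   tends to 1 by right continuity. *)
have cvr : B * (h x * w x / (h z * w z)) - 1 @[z --> x^'+] -->
    B * (h x * w x / (h x * w x)) - 1.
  apply: cvgB; last exact: cvg_cst.
  apply: cvgM; first exact: cvg_cst.
  apply: cvgM; first exact: cvg_cst.
  apply: cvgV; first by rewrite gt_eqF// mulr_gt0.
  apply: cvgM; first by apply: initial_tail_right; rewrite ?x0.
  by apply: initial_profile_right; rewrite ?x0.
rewrite divff ?mulr1 in cvr; last by rewrite gt_eqF// mulr_gt0.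
have near1 : \forall z \near x^'+, B * (h x * w x / (h z * w z)) - 1 < B + e - 1.
  by apply: (cvgr_lt _ cvr); rewrite ltrD2r ltrDl.
near=> z.
have xz : x < z by near: z; exact: nbhs_right_gt.
have zb : z < b by near: z; exact: nbhs_right_lt.
have z1 := lt_trans zb b1.
have z0 := le_trans x0 (ltW xz).
have wz := wp z; have hz := hp z; rewrite z0 z1 in wz hz.
have {}wz := wz isT; have {}hz := hz isT.
apply: (@le_trans _ _ ((B * (h x * w x / (h z * w z)) - 1) * (z - x))); last first.
  by rewrite ler_pM2r ?subr_gt0//; apply: ltW; near: z; exact: near1.
have I1 := initial_tail_ge hi (_ : 0 <= x <= z) (ltW z1).
rewrite x0 (ltW xz) -/w -/h in I1; have {}I1 := I1 isT.
have I2 := @density_le R c0 B x z hi (_ : 0 <= x <= z) z1 B0 _.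
rewrite x0 (ltW xz) -/w -/h in I2.
have {}I2 := I2 isT _; have {}I2 : w x - w z <= B * w x ^+ 2 / h z * (z - x).
  by apply: I2 => u /andP[xu u1]; apply: HB; rewrite u1 (le_trans yx).
have -> : h z / w z - h x / w x =
   h x * (w x - w z) / (w x * w z) - (h x - h z) / w z.
  by field; rewrite !gt_eqF.
have J1 : z - x <= (h x - h z) / w z by rewrite ler_pdivlMr// mulrC.
have J2 : h x * (w x - w z) / (w x * w z) <=
   h x * (B * w x ^+ 2 / h z * (z - x)) / (w x * w z).
  by rewrite ler_pM2r ?invr_gt0 ?mulr_gt0// ler_pM2l.
have E : h x * (B * w x ^+ 2 / h z * (z - x)) / (w x * w z) =
   B * (h x * w x / (h z * w z)) * (z - x).
  by field; rewrite !gt_eqF.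
rewrite E in J2; lra.
Unshelve. all: by end_near. Qed.

(** Counterpart of the lower estimate, where the boundary term cannot be dropped: h(b)/w(b) <= 1 - b
    because w is nonincreasing, and this vanishes as b tends to 1. *)
Lemma initial_tail_upper (R : realType) (c0 : R -> R) (B y : R) :
  initial_density c0 -> 0 <= y < 1 -> 0 <= B ->
  (forall x, y <= x < 1 -> B <= beta c0 (tail_integral c0) x) ->
  tail_integral (tail_integral c0) y <= (1 - B) * (1 - y) * tail_integral c0 y.
Proof.
move=> hi /andP[y0 y1] B0 HB.
set w := tail_integral c0; set h := tail_integral w.
have wp x : 0 <= x < 1 -> 0 < w x by exact: initial_profile_gt0.
have hp x : 0 <= x < 1 -> 0 < h x by exact: initial_tail_gt0.
rewrite -ler_pdivrMr; last by apply: wp; rewrite y0.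
suff H e : 0 < e -> h y / w y <= (1 - B + e) * (1 - y).
  apply/ler_addgt0Pr => e e0; have := H (e / (1 - y)).
  rewrite divr_gt0 ?subr_gt0// => /(_ isT).
  by rewrite mulrDl divfK ?gt_eqF ?subr_gt0.
move=> e0.
have cv : - ((1 - b) + (1 - B + e) * (b - y)) @[b --> 1^'-] -->
    - ((1 - 1) + (1 - B + e) * (1 - y)).
  apply: cvgN; apply: cvgD.
    by apply: cvgB; [exact: cvg_cst|exact/cvg_at_left_filter/cvg_id].
  apply: cvgM; first exact: cvg_cst.
  by apply: cvgB; [exact/cvg_at_left_filter/cvg_id|exact: cvg_cst].
rewrite -lerN2.
rewrite -(_ : - ((1 - 1) + (1 - B + e) * (1 - y)) = - ((1 - B + e) * (1 - y))); last by ring.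
apply: (at_left_lim_le y1 cv) => b /andP[yb b1].
have := @right_slope_le R (fun x => - (h x / w x)) y b (1 - B + e) (ltW yb).
move/(_ (within_continuousN (initial_ratio_continuous hi y0 b1))) => Hs.
have b0 := le_trans y0 (ltW yb).
suff : - (h b / w b) - - (h y / w y) <= (1 - B + e) * (b - y).
  have : h b / w b <= 1 - b.
    rewrite ler_pdivrMr ?wp ?b0//.
    have := initial_tail_le hi (_ : 0 <= b <= 1) (lexx 1).
    rewrite b0 (ltW b1) tail_integral1 subr0 => /(_ isT).
    by rewrite mulrC.
  by lra.
apply: Hs => x /andP[yx xb]; have x0 := le_trans y0 yx.
have x1 := lt_trans xb b1.
have wx := wp x; have hx := hp x; rewrite x0 x1 in wx hx.
have {}wx := wx isT; have {}hx := hx isT.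
have cvr : w x / w z - B * (w z / w x) @[z --> x^'+] -->
    w x / w x - B * (w x / w x).
  have cw : w z @[z --> x^'+] --> w x by apply: initial_profile_right; rewrite ?x0.
  apply: cvgB; apply: cvgM; [exact: cvg_cst| |exact: cvg_cst|].
    by apply: cvgV => //; rewrite gt_eqF.
  by apply: cvgM => //; exact: cvg_cst.
rewrite divff ?mulr1 in cvr; last by rewrite gt_eqF.
have near1 : \forall z \near x^'+, w x / w z - B * (w z / w x) < 1 - B + e.
  by apply: (cvgr_lt _ cvr); rewrite ltrDl.
near=> z.
have xz : x < z by near: z; exact: nbhs_right_gt.
have zb : z < b by near: z; exact: nbhs_right_lt.
have z1 := lt_trans zb b1.
have z0 := le_trans x0 (ltW xz).
have wz := wp z; have hz := hp z; rewrite z0 z1 in wz hz.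
have {}wz := wz isT; have {}hz := hz isT.
apply: (@le_trans _ _ ((w x / w z - B * (w z / w x)) * (z - x))); last first.
  by rewrite ler_pM2r ?subr_gt0//; apply: ltW; near: z; exact: near1.
have I1 := initial_tail_le hi (_ : 0 <= x <= z) (ltW z1).
rewrite x0 (ltW xz) -/w -/h in I1; have {}I1 := I1 isT.
have I2 := @density_ge R c0 B x z hi (_ : 0 <= x <= z) z1 B0 _.
rewrite x0 (ltW xz) -/w -/h in I2.
have {}I2 := I2 isT _; have {}I2 : B * w z ^+ 2 / h x * (z - x) <= w x - w z.
  by apply: I2 => u /andP[xu u1]; apply: HB; rewrite u1 (le_trans yx).
have -> : - (h z / w z) - - (h x / w x) =
   (h x - h z) / w z - h x * (w x - w z) / (w x * w z).
  by field; rewrite !gt_eqF.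
have J1 : (h x - h z) / w z <= w x / w z * (z - x).
  by rewrite mulrAC ler_pM2r ?invr_gt0.
have J2 : h x * (B * w z ^+ 2 / h x * (z - x)) / (w x * w z)
   <= h x * (w x - w z) / (w x * w z).
  by rewrite ler_pM2r ?invr_gt0 ?mulr_gt0// ler_pM2l.
have E : h x * (B * w z ^+ 2 / h x * (z - x)) / (w x * w z) =
   B * (w z / w x) * (z - x).
  by field; rewrite !gt_eqF.
rewrite E in J2; lra.
Unshelve. all: by end_near. Qed.

(** * Logarithmic comparison of the initial profile with powers of 1 - x *)

Lemma ln_le_subr1 (R : realType) (x : R) : 0 < x -> ln x <= x - 1.
Proof.
move=> x0; have := @expR_ge1Dx R (ln x); rewrite lnK ?posrE//; lra.
Qed.

Lemma ln_sub_le (R : realType) (x y : R) : 0 < x -> 0 < y ->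
  ln x - ln y <= (x - y) / y.
Proof.
move=> x0 y0; rewrite -ln_div ?posrE// mulrBl divff ?gt_eqF//.
by apply: ln_le_subr1; rewrite divr_gt0.
Qed.

Lemma one_sub_ln_continuous (R : realType) (y z : R) : z < 1 ->
  {within `[y, z], continuous (fun x : R => ln (1 - x))}.
Proof.
move=> z1; cont => x /=; rewrite in_itv/= => /andP[_ xz].
by rewrite subr_gt0 (le_lt_trans xz).
Qed.

Lemma initial_ln_continuous (R : realType) (c0 : R -> R) (y z : R) :
  initial_density c0 -> 0 <= y -> z < 1 ->
  {within `[y, z], continuous (fun x : R => ln (tail_integral c0 x))}.
Proof.
move=> hi y0 z1; apply: within_continuous_ln; last first.
  apply: continuous_subspaceW (initial_profile_continuous hi).
  by apply: subset_itv; rewrite bnd_simp// ltW.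
move=> x /=; rewrite in_itv/= => /andP[yx xz].
by apply: initial_profile_gt0 => //; rewrite (le_trans y0) ?(le_lt_trans xz).
Qed.

(** Formally (ln w)' = -beta w/h <= -B/((1 - b)(1 - x)) < -p/(1 - x), where b enters through the
    bound on h/w and B through beta itself. The strict inequality leaves room to move from x to
    nearby points, so the right slope bound holds with slope exactly 0. *)
Lemma initial_ln_upper (R : realType) (c0 : R -> R) (p b B y z : R) :
  initial_density c0 -> 0 <= y <= z -> z < 1 -> 0 <= p -> 0 <= b < 1 ->
  p * (1 - b) < B ->
  (forall x, y <= x < 1 -> b <= beta c0 (tail_integral c0) x) ->
  (forall x, y <= x < 1 -> B <= beta c0 (tail_integral c0) x) ->
  ln (tail_integral c0 z) - ln (tail_integral c0 y) <=
  p * (ln (1 - z) - ln (1 - y)).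
Proof.
move=> hi /andP[y0 yz] z1 p0 /andP[b0 b1] pB Hb HB.
set w := tail_integral c0; set h := tail_integral w.
have wp x : 0 <= x < 1 -> 0 < w x by exact: initial_profile_gt0.
have hp x : 0 <= x < 1 -> 0 < h x by exact: initial_tail_gt0.
have B0 : 0 <= B by apply/ltW/(le_lt_trans _ pB); rewrite mulr_ge0// subr_ge0 ltW.
have := @right_slope_le R (fun x => ln (w x) + - (p * ln (1 - x))) y z 0 yz.
rewrite mul0r => H; suff : ln (w z) + - (p * ln (1 - z)) - (ln (w y) + - (p * ln (1 - y))) <= 0.
  by rewrite mulrBr; lra.
apply: H.
  apply: within_continuousD; first exact: initial_ln_continuous.
  apply: within_continuousN; apply: within_continuousM.
    exact: within_continuous_cst.
  exact: one_sub_ln_continuous.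
move=> x /andP[yx xz]; have x0 := le_trans y0 yx.
have x1 := lt_trans xz z1.
have wx := wp x; have hx := hp x; rewrite x0 x1 in wx hx.
have {}wx := wx isT; have {}hx := hx isT.
have cvr : p / (1 - u) - B * w u ^+ 2 / (h x * w x) @[u --> x^'+] -->
    p / (1 - x) - B * w x ^+ 2 / (h x * w x).
  have cw : w z @[z --> x^'+] --> w x by apply: initial_profile_right; rewrite ?x0.
  apply: cvgB; apply: cvgM; try exact: cvg_cst.
    apply: cvgV; first by rewrite gt_eqF// subr_gt0.
    by apply: cvgB; [exact: cvg_cst|exact/cvg_at_right_filter/cvg_id].
  by apply: cvgM; [exact: cvg_cst|exact: cvgM].
have neg : p / (1 - x) - B * w x ^+ 2 / (h x * w x) < 0.
  have := @initial_tail_upper R c0 b x hi _ b0.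
  rewrite x0 x1 -/w -/h => /(_ isT) Hx.
  have {}Hx : h x <= (1 - b) * (1 - x) * w x.
    by apply: Hx => u /andP[xu u1]; apply: Hb; rewrite u1 (le_trans yx).
  have -> : B * w x ^+ 2 / (h x * w x) = B * (w x / h x).
    by field; rewrite !gt_eqF.
  rewrite subr_lt0; apply: (@lt_le_trans _ _ (B / ((1 - b) * (1 - x)))).
    by rewrite invfM mulrA ltr_pM2r ?invr_gt0 ?subr_gt0// ltr_pdivlMr ?subr_gt0.
  rewrite ler_wpM2l// ler_pdivlMr// mulrC ler_pdivrMr ?mulr_gt0 ?subr_gt0//.
  by rewrite mulrC.
have near1 : \forall u \near x^'+, p / (1 - u) - B * w u ^+ 2 / (h x * w x) < 0.
  exact: (cvgr_lt _ cvr).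
near=> u.
have xu : x < u by near: u; exact: nbhs_right_gt.
have u1 : u < 1 by near: u; exact: nbhs_right_lt.
have u0 := le_trans x0 (ltW xu).
have wu := wp u; rewrite u0 u1 in wu; have {}wu := wu isT.
rewrite mul0r.
have I1 := @density_ge R c0 B x u hi (_ : 0 <= x <= u) u1 B0 _.
rewrite x0 (ltW xu) -/w -/h in I1.
have {}I1 := I1 isT _; have {}I1 : B * w u ^+ 2 / h x * (u - x) <= w x - w u.
  by apply: I1 => v /andP[xv v1]; apply: HB; rewrite v1 (le_trans yx).
have L1 := ln_sub_le wu wx.
have L2 : ln (1 - x) - ln (1 - u) <= (u - x) / (1 - u).
  have := @ln_sub_le R (1 - x) (1 - u); rewrite !subr_gt0 => /(_ x1 u1).
  by rewrite (_ : 1 - x - (1 - u) = u - x)//; ring.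
have L3 : p * (ln (1 - x) - ln (1 - u)) <= p * ((u - x) / (1 - u)) by rewrite ler_wpM2l.
have L4 : (w u - w x) / w x <= - (B * w u ^+ 2 / (h x * w x) * (u - x)).
  rewrite ler_pdivrMr// mulNr -subr_ge0.
  have -> : B * w u ^+ 2 / (h x * w x) * (u - x) * w x = B * w u ^+ 2 / h x * (u - x).
    by field; rewrite !gt_eqF.
  lra.
have L5 : (p / (1 - u) - B * w u ^+ 2 / (h x * w x)) * (u - x) <= 0.
  by rewrite mulr_le0_ge0 ?subr_ge0 ?(ltW xu)//; apply: ltW; near: u; exact: near1.
rewrite mulrBl in L5; lra.
Unshelve. all: by end_near. Qed.

(** The same computation with the inequalities reversed: beta w/h <= B/((1 - b)(1 - x)) < q/(1 -
    x). *)
Lemma initial_ln_lower (R : realType) (c0 : R -> R) (q b B y z : R) :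
  initial_density c0 -> 0 <= y <= z -> z < 1 -> 0 <= q -> 0 <= b < 1 -> 0 <= B ->
  B < q * (1 - b) ->
  (forall x, y <= x < 1 -> beta c0 (tail_integral c0) x <= b) ->
  (forall x, y <= x < 1 -> beta c0 (tail_integral c0) x <= B) ->
  q * (ln (1 - z) - ln (1 - y)) <=
  ln (tail_integral c0 z) - ln (tail_integral c0 y).
Proof.
move=> hi /andP[y0 yz] z1 q0 /andP[b0 b1] B0 pB Hb HB.
set w := tail_integral c0; set h := tail_integral w.
have wp x : 0 <= x < 1 -> 0 < w x by exact: initial_profile_gt0.
have hp x : 0 <= x < 1 -> 0 < h x by exact: initial_tail_gt0.
have := @right_slope_le R (fun x => q * ln (1 - x) + - ln (w x)) y z 0 yz.
rewrite mul0r => H; suff : q * ln (1 - z) + - ln (w z) - (q * ln (1 - y) + - ln (w y)) <= 0.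
  by rewrite mulrBr; lra.
apply: H.
  apply: within_continuousD; last exact/within_continuousN/initial_ln_continuous.
  apply: within_continuousM.
    exact: within_continuous_cst.
  exact: one_sub_ln_continuous.
move=> x /andP[yx xz]; have x0 := le_trans y0 yx.
have x1 := lt_trans xz z1.
have wx := wp x; have hx := hp x; rewrite x0 x1 in wx hx.
have {}wx := wx isT; have {}hx := hx isT.
have cvr : B * w x ^+ 2 / (h u * w u) - q / (1 - x) @[u --> x^'+] -->
    B * w x ^+ 2 / (h x * w x) - q / (1 - x).
  apply: cvgB; last exact: cvg_cst.
  apply: cvgM; first exact: cvg_cst.
  apply: cvgV; first by rewrite gt_eqF// mulr_gt0.
  apply: cvgM; first by apply: initial_tail_right; rewrite ?x0.
  by apply: initial_profile_right; rewrite ?x0.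
have neg : B * w x ^+ 2 / (h x * w x) - q / (1 - x) < 0.
  have := @initial_tail_lower R c0 b x hi _ b0.
  rewrite x0 x1 -/w -/h => /(_ isT) Hx.
  have {}Hx : (1 - b) * (1 - x) * w x <= h x.
    by apply: Hx => u /andP[xu u1]; apply: Hb; rewrite u1 (le_trans yx).
  have -> : B * w x ^+ 2 / (h x * w x) = B * (w x / h x).
    by field; rewrite !gt_eqF.
  rewrite subr_lt0; apply: (@le_lt_trans _ _ (B / ((1 - b) * (1 - x)))).
    rewrite ler_wpM2l// ler_pdivrMr// mulrC ler_pdivlMr ?mulr_gt0 ?subr_gt0//.
    by rewrite mulrC.
  by rewrite invfM mulrA ltr_pM2r ?invr_gt0 ?subr_gt0// ltr_pdivrMr ?subr_gt0.
have near1 : \forall u \near x^'+, B * w x ^+ 2 / (h u * w u) - q / (1 - x) < 0.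
  exact: (cvgr_lt _ cvr).
near=> u.
have xu : x < u by near: u; exact: nbhs_right_gt.
have u1 : u < 1 by near: u; exact: nbhs_right_lt.
have u0 := le_trans x0 (ltW xu).
have wu := wp u; have hu := hp u; rewrite u0 u1 in wu hu.
have {}wu := wu isT; have {}hu := hu isT.
rewrite mul0r.
have I1 := @density_le R c0 B x u hi (_ : 0 <= x <= u) u1 B0 _.
rewrite x0 (ltW xu) -/w -/h in I1.
have {}I1 := I1 isT _; have {}I1 : w x - w u <= B * w x ^+ 2 / h u * (u - x).
  by apply: I1 => v /andP[xv v1]; apply: HB; rewrite v1 (le_trans yx).
have L1 := ln_sub_le wx wu.
have L2 : ln (1 - u) - ln (1 - x) <= (x - u) / (1 - x).
  have := @ln_sub_le R (1 - u) (1 - x); rewrite !subr_gt0 => /(_ u1 x1).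
  by rewrite (_ : 1 - u - (1 - x) = x - u)//; ring.
have L3 : q * (ln (1 - u) - ln (1 - x)) <= q * ((x - u) / (1 - x)) by rewrite ler_wpM2l.
have L4 : (w x - w u) / w u <= B * w x ^+ 2 / (h u * w u) * (u - x).
  rewrite ler_pdivrMr//.
  have -> // : B * w x ^+ 2 / (h u * w u) * (u - x) * w u = B * w x ^+ 2 / h u * (u - x).
  by field; rewrite !gt_eqF.
have L5 : (B * w x ^+ 2 / (h u * w u) - q / (1 - x)) * (u - x) <= 0.
  by rewrite mulr_le0_ge0 ?subr_ge0 ?(ltW xu)//; apply: ltW; near: u; exact: near1.
rewrite mulrBl in L5.
have L6 : q * ((x - u) / (1 - x)) = - (q / (1 - x) * (u - x)) by ring.
rewrite L6 in L3; lra.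
Unshelve. all: by end_near. Qed.

Lemma initial_ln_asymptotics (R : realType) (c0 : R -> R) (beta0 e : R) :
  initial_density c0 -> 0 < beta0 < 1 -> 0 < e ->
  beta c0 (tail_integral c0) x @[x --> 1^'-] --> beta0 ->
  exists2 a, 0 <= a < 1 & forall y z, a <= y <= z -> z < 1 ->
    (beta0 / (1 - beta0) + e) * (ln (1 - z) - ln (1 - y)) <=
    ln (tail_integral c0 z) - ln (tail_integral c0 y) <=
    (beta0 / (1 - beta0) - e) * (ln (1 - z) - ln (1 - y)).
Proof.
move=> hi /andP[b0 b1] e0 hb.
(* This keeps the exponent p - e nonnegative; a larger e only weakens both bounds, as ln (1 - z) -
   ln (1 - y) <= 0. *)
wlog ep : e e0 / e <= beta0 / (1 - beta0).
  move=> H; have [ep|pe] := leP e (beta0 / (1 - beta0)); first exact: H.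
  have p0 : 0 < beta0 / (1 - beta0) by rewrite divr_gt0 ?subr_gt0.
  have [a ha Ha] := H _ p0 (lexx _).
  exists a => // y z ayz z1; have /andP[L U] := Ha y z ayz z1.
  have dle0 : ln (1 - z) - ln (1 - y) <= 0.
    case/andP: ayz => ay yz; rewrite subr_le0 ler_ln ?posrE ?subr_gt0//; first lra.
    exact: le_lt_trans z1.
  apply/andP; split.
    by apply: le_trans L; rewrite ler_wnM2r// lerD2l ltW.
  by apply: (le_trans U); rewrite ler_wnM2r// lerD2l lerN2 ltW.
set p := beta0 / (1 - beta0) in ep *.
have pE : p * (1 - beta0) = beta0 by rewrite /p divfK// gt_eqF// subr_gt0.
(* The first two terms keep beta0 - d and beta0 + d in [0, 1[. Since p (1 - beta0) = beta0, the
   third gives beta0 + d < (p + e)(1 - beta0 - d) and (p - e)(1 - beta0 + d) < beta0 - d. *)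
pose d := Num.min (Num.min (beta0 / 2) ((1 - beta0) / 2)) (e * (1 - beta0) / (2 * (1 + p + e))).
have p0 : 0 < p by rewrite divr_gt0// subr_gt0.
have P0 : 0 < 2 * (1 + p + e) by lra.
have d0 : 0 < d.
  rewrite !lt_min !divr_gt0 ?mulr_gt0 ?subr_gt0//; lra.
have d1 : d <= beta0 / 2 by rewrite /d !ge_min lexx.
have d2 : d <= (1 - beta0) / 2 by rewrite /d !ge_min lexx orbT.
have d3 : d * (2 * (1 + p + e)) <= e * (1 - beta0).
  by rewrite -ler_pdivlMr// /d !ge_min lexx !orbT.
have dp : 0 <= d * p by rewrite mulr_ge0// ltW.
have de : 0 < d * e by rewrite mulr_gt0.
have near1 : \forall x \near 1^'-, `|beta0 - beta c0 (tail_integral c0) x| < d.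
  by move/cvgrPdist_lt : hb; apply.
case: near1 => r /= r0' Hr; have r0 : 0 < r := r0'.
pose a : R := Num.max 0 (1 - r / 2).
have a01 : 0 <= a < 1 by rewrite /a le_max lexx/= gt_max; lra.
have ar : 1 - r / 2 <= a by rewrite /a le_max lexx orbT.
have Ha (x : R) : a <= x < 1 -> beta0 - d <= beta c0 (tail_integral c0) x <= beta0 + d.
  move=> /andP[ax x1].
  have H : `|beta0 - beta c0 (tail_integral c0) x| < d.
    apply: (Hr x _ x1); rewrite /= gtr0_norm ?subr_gt0//.
    have : 1 - r / 2 <= x by exact: le_trans ax.
    lra.
  by move: H; rewrite ltr_norml => /andP[]; lra.
exists a => // y z /andP[ay yz] z1; case/andP: a01 => a0 a1.
have y0 := le_trans a0 ay.
have Hl (x : R) : y <= x < 1 -> beta0 - d <= beta c0 (tail_integral c0) x.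
  by move=> /andP[yx x1]; have := Ha x; rewrite x1 (le_trans ay yx) => /(_ isT)/andP[].
have Hu (x : R) : y <= x < 1 -> beta c0 (tail_integral c0) x <= beta0 + d.
  by move=> /andP[yx x1]; have := Ha x; rewrite x1 (le_trans ay yx) => /(_ isT)/andP[].
apply/andP; split.
  by apply: (@initial_ln_lower R c0 (p + e) (beta0 + d) (beta0 + d)) => //; rewrite ?y0 ?yz//; nra.
by apply: (@initial_ln_upper R c0 (p - e) (beta0 - d) (beta0 - d)) => //; rewrite ?y0 ?yz//; nra.
Qed.

(** On [0, a] a nonincreasing f loses at most f 0 - f a, so the comparison valid near 1 extends to
    all of [0, 1[ at that additive cost. *)
Lemma extend_lower_bound (R : realType) (f g : R -> R) (q a : R) :
  0 <= q -> 0 <= a < 1 ->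
  (forall y z, 0 <= y <= z -> z < 1 -> f z <= f y) ->
  (forall y z, 0 <= y <= z -> z < 1 -> g z <= g y) ->
  (forall y z, a <= y <= z -> z < 1 -> q * (g z - g y) <= f z - f y) ->
  forall y z, 0 <= y <= z -> z < 1 -> q * (g z - g y) - (f 0 - f a) <= f z - f y.
Proof.
move=> q0 /andP[a0 a1] fn gn H y z /andP[y0 yz] z1.
have z0 := le_trans y0 yz.
have f0a : f a <= f 0 by apply: fn; rewrite ?lexx.
have [ay|/ltW ya] := leP a y.
  have : q * (g z - g y) <= f z - f y by apply: H; rewrite ?ay.
  lra.
have f0y : f y <= f 0 by apply: fn; rewrite ?lexx// (le_lt_trans ya).
have [za|/ltW az] := leP z a.
  have fza : f a <= f z by apply: fn; rewrite ?z0.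
  have gyz : g z <= g y by apply: gn; rewrite ?y0.
  have : q * (g z - g y) <= 0 by rewrite mulr_ge0_le0// subr_le0.
  lra.
have Haz : q * (g z - g a) <= f z - f a by apply: H; rewrite ?lexx.
have gya : g a <= g y by apply: gn; rewrite ?y0.
have : q * (g z - g y) <= q * (g z - g a) by rewrite ler_wpM2l// lerD2l lerN2.
lra.
Qed.

Lemma initial_ln_lower_global (R : realType) (c0 : R -> R) (q a : R) :
  initial_density c0 -> 0 <= q -> 0 <= a < 1 ->
  (forall y z, a <= y <= z -> z < 1 ->
    q * (ln (1 - z) - ln (1 - y)) <=
    ln (tail_integral c0 z) - ln (tail_integral c0 y)) ->
  forall y z, 0 <= y <= z -> z < 1 ->
    q * (ln (1 - z) - ln (1 - y)) -
      (ln (tail_integral c0 0) - ln (tail_integral c0 a)) <=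
    ln (tail_integral c0 z) - ln (tail_integral c0 y).
Proof.
move=> hi q0 a01 H.
apply: (@extend_lower_bound R (fun x => ln (tail_integral c0 x))
  (fun x => ln (1 - x)) q a q0 a01 _ _ H) => y z /andP[y0 yz] z1.
  rewrite ler_ln ?posrE; first last.
  - by apply: initial_profile_gt0; rewrite // y0 (le_lt_trans yz).
  - by apply: initial_profile_gt0; rewrite // (le_trans y0 yz).
  - by apply: initial_profile_noninc; rewrite ?y0 ?(ltW z1).
rewrite ler_ln ?posrE ?subr_gt0 ?(le_lt_trans yz)//.
by rewrite lerD2l lerN2.
Qed.

(** * Solutions *)

(** If the chord slopes were replaced by their limits at 1, the logarithmic gap would be exactly al
    int kappa - A t. The error rate lies between -L (1 + kappa)(1 - X) and 0, so its integral is
    bounded by the budget. *)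
Lemma characteristic_average (R : realType) (phi psi kappa : R -> R)
    (al A B L x t M : R) (X E E' : R -> R) :
  drift_bounds phi psi al A B L -> {within `[0, +oo[%classic, continuous kappa} ->
  (forall s, 0 <= s -> 0 < kappa s) -> 0 < t ->
  characteristic phi psi kappa x t X -> x < 1 ->
  {within `[0, t], continuous E} ->
  (forall s, 0 < s < t -> is_derive s (1 : R) E (E' s)) ->
  (forall s, 0 < s < t -> (1 + kappa s) * (1 - X s) <= E' s) ->
  (forall s, 0 <= s <= t -> 0 <= E s <= M) ->
  - (L * M) <= al * (\int[lebesgue_measure]_(s in `[0%R, t]) kappa s) - A * t -
    (ln (1 - x) - ln (1 - X 0)) <= 0.
Proof.
move=> db ck kp t0 hX x1 cE dE bE HM.
have X1 := characteristic_lt1 db ck kp hX x1.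
have cX := characteristic_ln_continuous hX X1.
have ckt : {within `[0, t], continuous kappa} := within_ray_segment ck.
have ik : lebesgue_measure.-integrable `[0%R, t] (EFin \o kappa).
  exact: continuous_compact_integrable (@segment_compact R 0 t) ckt.
pose K s := parameterized_integral lebesgue_measure 0 s kappa.
have cK : {within `[0, t], continuous K}.
  exact: parameterized_integral_continuous (ltW t0) ik.
have dK (s : R) : 0 < s < t -> is_derive s (1 : R) K (kappa s).
  move=> /andP[s0 st]; have cs : {for s, continuous kappa}.
    by move/(continuous_within_itvP _ t0) : ckt => [+ _ _]; apply; rewrite in_itv/= s0.
  have [dKs Ks] := continuous_FTC1_closed st ik s0 cs.
  by apply: DeriveDef; [exact: dKs|rewrite -derive1E; exact: Ks].
have K0 : K 0 = 0.
  by rewrite /K /parameterized_integral set_itv1 Rintegral_set1.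
rewrite -/(parameterized_integral lebesgue_measure 0 t kappa) -/(K t).
have L0 := db_L db.
have cons (s : R) : 0 < s < t -> [/\ 0 <= X s < 1, kappa s * al <= kappa s * slope1 psi (X s),
    slope1 phi (X s) <= A,
    kappa s * slope1 psi (X s) <= kappa s * (al + L * (1 - X s)) &
    A - L * (1 - X s) <= slope1 phi (X s)].
  move=> /andP[s0 st]; have s0t : 0 <= s <= t by rewrite !ltW.
  have Xs1 := X1 s s0t; have [/(_ s s0t)/andP[Xs0 Xs1'] _ _ _] := hX.
  have ks := ltW (kp s (ltW s0)).
  have Xs01 : 0 <= X s < 1 by rewrite Xs0.
  have P := db_phi_incr db (_ : 0 <= X s <= 1) (lexx 1).
  have Q := db_psi_incr db (_ : 0 <= X s <= 1) (lexx 1).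
  rewrite Xs0 Xs1' (db_phi1 db) in P; rewrite Xs0 Xs1' (db_psi1 db) in Q.
  have {}P := P isT; have {}Q := Q isT.
  split=> //.
  - by rewrite ler_wpM2l// /slope1 ler_pdivlMr ?subr_gt0//; lra.
  - by rewrite /slope1 ler_pdivrMr ?subr_gt0//; lra.
  - by rewrite ler_wpM2l// (db_psi_lim db Xs01).
  - by rewrite (db_phi_lim db Xs01).
pose P s := al * K s - A * s - ln (1 - X s).
pose P' s := al * kappa s - A - (kappa s * slope1 psi (X s) - slope1 phi (X s)).
have cP : {within `[0, t], continuous P} by rewrite /P; cont.
have dP (s : R) : 0 < s < t -> is_derive s (1 : R) P (P' s).
  move=> s0t; have dKs := dK s s0t.
  have s0t' : 0 <= s <= t by case/andP: s0t => *; rewrite !ltW.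
  have dXs := characteristic_ln_derive hX s0t (X1 s s0t').
  by rewrite /P /P'; der_eq; rewrite /=; ring.
have Pt : P t - P 0 = al * K t - A * t - (ln (1 - x) - ln (1 - X 0)).
  by rewrite /P K0; have [_ _ _ ->] := hX; ring.
rewrite -Pt; apply/andP; split; last first.
  rewrite subr_le0; apply: (derive_le0_le (ltW t0) cP dP) => s s0t.
  by have [_ H1 H2 _ _] := cons s s0t; rewrite /P'; lra.
have : - (P t + L * E t) <= - (P 0 + L * E 0).
  apply: (@derive_le0_le R (fun s => - (P s + L * E s))
    (fun s => - (P' s + L * E' s)) 0 t (ltW t0)).
  - by cont.
  - by move=> s s0t; have dPs := dP s s0t; have dEs := dE s s0t; der_eq; rewrite /=; ring.
  - move=> s s0t; have [_ _ _ H1 H2] := cons s s0t; rewrite /P'.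
    have : L * ((1 + kappa s) * (1 - X s)) <= L * E' s by rewrite ler_wpM2l// bE.
    lra.
have H00 : (0 : R) <= 0 <= t by rewrite lexx ltW.
have Htt : 0 <= t <= t by rewrite lexx ltW.
have /andP[E00 _] := HM 0 H00; have /andP[_ EtM] := HM t Htt.
have : L * (E t - E 0) <= L * M by rewrite ler_wpM2l//; lra.
lra.
Qed.

Lemma continuous_within_comp_in (R : realType) (A B : set R) (f h : R -> R) :
  {within A, continuous f} -> (forall x, A x -> B (f x)) ->
  {within B, continuous h} -> {within A, continuous (fun y => h (f y))}.
Proof.
move=> cf AB ch; apply/subspace_continuousP => x Ax.
move/subspace_continuousP : cf => /(_ x Ax) cf.
move/subspace_continuousP : ch => /(_ _ (AB x Ax)) ch.
apply: cvg_comp ch => U; rewrite /= /within/= => nU.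
have := cf _ nU; rewrite /= /within/= /nbhs/=.
by apply: filterS => z /= H Az; apply: H => //; exact: AB.
Qed.

Lemma lipschitz_within_continuous (R : realType) (A : set R) (f : R -> R) (K : R) :
  0 < K -> (forall x y, A x -> A y -> x <= y -> `|f y - f x| <= K * (y - x)) ->
  {within A, continuous f}.
Proof.
move=> K0 H; apply/subspace_continuousP => x Ax.
apply/cvgrPdist_lt => e e0; rewrite /within/=.
exists (e / K) => /=; first by rewrite divr_gt0.
move=> y; rewrite /ball_/= ltr_pdivlMr// mulrC => xy Ay.
apply: le_lt_trans xy; have [xy|/ltW yx] := leP x y.
  by rewrite distrC (distrC x y) (ger0_norm (_ : 0 <= y - x)) ?subr_ge0//; exact: H.
by rewrite (ger0_norm (_ : 0 <= x - y)) ?subr_ge0//; exact: H.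
Qed.

Lemma solution_characteristic (R : realType) (phi psi w0 kappa : R -> R)
    (w : R -> R -> R) (x t : R) :
  solution phi psi w0 kappa w -> 0 <= x < 1 -> 0 <= t ->
  exists X, characteristic phi psi kappa x t X.
Proof. by move=> [_ _ [F bF _] _] x01 t0; have [X hX _] := bF x t x01 t0; exists X. Qed.

(** The characteristic behind F is only known to exist; order preservation, applied in both
    directions with equal end points, shows that any other one has the same foot. *)
Lemma solution_along (R : realType) (phi psi w0 kappa : R -> R)
    (al A B L x t : R) (w : R -> R -> R) (X : R -> R) :
  drift_bounds phi psi al A B L -> solution phi psi w0 kappa w ->
  0 <= x < 1 -> 0 <= t -> characteristic phi psi kappa x t X ->
  w x t = expR t * w0 (X 0).
Proof.
move=> db [_ kp [F bF wF] _] x01 t0 hX; rewrite wF//.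
have [Y hY ->] := bF x t x01 t0; congr (_ * w0 _).
have H00 : (0 : R) <= 0 <= t by rewrite lexx.
apply/eqP; rewrite eq_le (characteristic_mono db kp hX hY (lexx x) H00).
by rewrite (characteristic_mono db kp hY hX (lexx x) H00).
Qed.

Lemma solution_transport (R : realType) (phi psi w0 kappa : R -> R)
    (al A B L x t s : R) (w : R -> R -> R) (X : R -> R) :
  drift_bounds phi psi al A B L -> solution phi psi w0 kappa w ->
  0 <= x < 1 -> 0 <= s <= t -> characteristic phi psi kappa x t X ->
  w x t = expR (t - s) * w (X s) s.
Proof.
move=> db hs x01 /[dup] s0t /andP[s0 st] hX.
have [ck kp _ _] := hs; have x1 : x < 1 by case/andP: x01.
have Xs1 := characteristic_lt1 db ck kp hX x1 s0t.
have [X01 _ _ _] := hX; have /andP[Xs0 _] := X01 s s0t.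
rewrite (solution_along db hs x01 (le_trans s0 st) hX).
rewrite (solution_along db hs _ s0 (characteristic_restrict hX s0t)) ?Xs0//.
by rewrite mulrA -expRD subrK.
Qed.

Lemma solution_noninc (R : realType) (phi psi c0 kappa : R -> R)
    (al A B L x y t : R) (w : R -> R -> R) :
  drift_bounds phi psi al A B L -> initial_density c0 ->
  solution phi psi (tail_integral c0) kappa w ->
  0 <= x <= y -> y < 1 -> 0 <= t -> w y t <= w x t.
Proof.
move=> db hi hs /andP[x0 xy] y1 t0; have x1 := le_lt_trans xy y1.
have x01 : 0 <= x < 1 by rewrite x0.
have y01 : 0 <= y < 1 by rewrite (le_trans x0).
have [X hX] := solution_characteristic hs x01 t0.
have [Y hY] := solution_characteristic hs y01 t0.
rewrite (solution_along db hs x01 t0 hX) (solution_along db hs y01 t0 hY).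
have [ck kp _ _] := hs; have H00 : (0 : R) <= 0 <= t by rewrite lexx.
rewrite ler_pM2l ?expR_gt0//; apply: initial_profile_noninc => //.
  rewrite (characteristic_mono db kp hX hY xy)// andbT.
  by have [/(_ 0 H00)/andP[]] := hX.
by have [/(_ 0 H00)/andP[]] := hY.
Qed.

Lemma solution_gt0 (R : realType) (phi psi c0 kappa : R -> R)
    (al A B L x t : R) (w : R -> R -> R) :
  drift_bounds phi psi al A B L -> initial_density c0 ->
  solution phi psi (tail_integral c0) kappa w ->
  0 <= x < 1 -> 0 <= t -> 0 < w x t.
Proof.
move=> db hi hs x01 t0.
have [X hX] := solution_characteristic hs x01 t0.
rewrite (solution_along db hs x01 t0 hX) mulr_gt0 ?expR_gt0//.
have [ck kp _ _] := hs; have H00 : (0 : R) <= 0 <= t by rewrite lexx.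
apply: initial_profile_gt0 => //; case/andP: x01 => x0 x1.
rewrite (characteristic_lt1 db ck kp hX x1)// andbT.
by have [/(_ 0 H00)/andP[]] := hX.
Qed.

(* [w x t] is unspecified for x = 1, where continuity forces the value 0. *)
Definition profile_ext (R : realType) (w : R -> R -> R) (t x : R) : R :=
  if x < 1 then w x t else 0.

(** F(., t), extended by 1 at x = 1, is Lipschitz: F(y) - F(x) is at most y - x times the chord
    slope (1 - F(x))/(1 - x), which the kappa-free growth bound keeps below e^{A t}. *)
Lemma solution_continuous (R : realType) (phi psi c0 kappa : R -> R)
    (al A B L t : R) (w : R -> R -> R) :
  drift_bounds phi psi al A B L -> initial_density c0 ->
  solution phi psi (tail_integral c0) kappa w -> 0 <= t ->
  {within `[0, 1], continuous (profile_ext w t)}.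
Proof.
move=> db hi hs t0; have [ck kp [F bF wF] _] := hs.
pose G x := if x < 1 then F x t else 1.
have H00 : (0 : R) <= 0 <= t by rewrite lexx.
have Ggap x : 0 <= x <= 1 -> 0 <= G x <= 1 /\ 1 - G x <= expR (A * t) * (1 - x).
  move=> /andP[x0 x1]; rewrite /G; case: ltP => [{}x1|x1'].
    have x01 : 0 <= x < 1 by rewrite x0.
    have [X hX ->] := bF x t x01 t0; split; first by have [/(_ 0 H00)] := hX.
    by have := characteristic_gap_le db kp hX H00; rewrite subr0.
  rewrite ler01 lexx subrr; split=> //.
  by rewrite mulr_ge0 ?expR_ge0// subr_ge0.
have cG : {within `[0, 1], continuous G}.
  apply: (@lipschitz_within_continuous _ _ _ (expR (A * t))); first exact: expR_gt0.
  move=> x y /=; rewrite !in_itv/= => x01 y01 xy.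
  have [/andP[Gx0 Gx1] Gx] := Ggap x x01.
  case/andP: x01 => x0 x1; case/andP: y01 => y0 y1.
  have [{}y1|y1'] := ltP y 1; last first.
    have -> : y = 1 by apply/eqP; rewrite eq_le y1 y1'.
    by rewrite {1}/G ltxx ger0_norm ?subr_ge0.
  have {}x1 := le_lt_trans xy y1.
  move: Gx; rewrite /G x1 y1.
  have x01 : 0 <= x < 1 by rewrite x0.
  have y01 : 0 <= y < 1 by rewrite y0.
  have [X hX ->] := bF x t x01 t0; have [Y hY ->] := bF y t y01 t0 => XA.
  have XY := characteristic_mono db kp hX hY xy H00.
  rewrite ger0_norm ?subr_ge0//.
  have X1 := characteristic_lt1 db ck kp hX x1 H00.
  have Y1 := characteristic_lt1 db ck kp hY y1 H00.
  have := characteristic_ln_ratio db ck kp hX hY xy y1 H00.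
  rewrite -!ln_div ?posrE ?subr_gt0//.
  rewrite ler_ln ?posrE ?divr_gt0 ?subr_gt0//.
  rewrite ler_pdivlMr ?subr_gt0// => H.
  have -> : Y 0 - X 0 = (1 - X 0) - (1 - Y 0) by ring.
  apply: (@le_trans _ _ ((1 - X 0) / (1 - x) * (y - x))).
    have -> : (1 - X 0) / (1 - x) * (y - x) = (1 - X 0) - (1 - y) / (1 - x) * (1 - X 0).
      by field; rewrite gt_eqF// subr_gt0.
    by rewrite lerD2l lerN2.
  by rewrite ler_wpM2r ?subr_ge0// ler_pdivrMr ?subr_gt0.
have cw : {within `[0, 1], continuous (fun x => expR t * tail_integral c0 (G x))}.
  apply: within_continuousM; first exact: within_continuous_cst.
  apply: (continuous_within_comp_in cG _ (initial_profile_continuous hi)).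
  by move=> x /=; rewrite !in_itv/= => /Ggap[].
apply: subspace_eq_continuous cw => x; rewrite inE/= in_itv/= => /andP[x0 x1].
rewrite /from_subspace /profile_ext /G; case: ltP => [{}x1|_].
  by rewrite wF ?x0.
by rewrite tail_integral1 mulr0.
Qed.

Lemma solution_mass (R : realType) (phi psi w0 kappa : R -> R)
    (w : R -> R -> R) (t : R) :
  solution phi psi w0 kappa w -> 0 <= t -> tail_integral (profile_ext w t) 0 = 1.
Proof.
move=> [_ _ _ mass] t0; rewrite -[RHS](mass t t0); apply: eq_tail_integral.
by move=> z /andP[z0 z1]; rewrite /profile_ext z1.
Qed.

Lemma solution_mass_le (R : realType) (phi psi c0 kappa : R -> R)
    (al A B L x t : R) (w : R -> R -> R) :
  drift_bounds phi psi al A B L -> initial_density c0 ->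
  solution phi psi (tail_integral c0) kappa w -> 0 <= x < 1 -> 0 <= t ->
  1 <= w 0 t * x + w x t * (1 - x).
Proof.
move=> db hi hs /andP[x0 x1] t0.
have iW := within_continuous_integrable (solution_continuous db hi hs t0).
have Wn z r : 0 <= z <= r -> r < 1 -> w r t <= w z t.
  by move=> zr r1; exact: solution_noninc db hi hs zr r1 t0.
have := @tail_integralB_le R _ 0 x (w 0 t) iW _ (ltW x1) _.
rewrite lexx x0 subr0 => /(_ isT) H1.
have {}H1 : tail_integral (profile_ext w t) 0 - tail_integral (profile_ext w t) x
    <= w 0 t * x.
  apply: H1 => z /andP[z0 zx]; rewrite /profile_ext (lt_trans zx x1).
  by apply: Wn; rewrite ?lexx ?(lt_trans zx x1).
have := @tail_integralB_le R _ x 1 (w x t) iW _ (lexx 1) _.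
rewrite x0 (ltW x1) tail_integral1 subr0 => /(_ isT) H2.
have {}H2 : tail_integral (profile_ext w t) x <= w x t * (1 - x).
  apply: H2 => z /andP[xz z1]; rewrite /profile_ext z1.
  by apply: Wn; rewrite ?x0.
rewrite (solution_mass hs t0) in H1; lra.
Qed.

Lemma solution_mass_ge (R : realType) (phi psi c0 kappa : R -> R)
    (al A B L x t : R) (w : R -> R -> R) :
  drift_bounds phi psi al A B L -> initial_density c0 ->
  solution phi psi (tail_integral c0) kappa w -> 0 <= x < 1 -> 0 <= t ->
  1 - w 0 t * x <= tail_integral (profile_ext w t) x <= 1 - w x t * x.
Proof.
move=> db hi hs /andP[x0 x1] t0.
have iW := within_continuous_integrable (solution_continuous db hi hs t0).
have Wn z r : 0 <= z <= r -> r < 1 -> w r t <= w z t.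
  by move=> zr r1; exact: solution_noninc db hi hs zr r1 t0.
have := @tail_integralB_le R _ 0 x (w 0 t) iW _ (ltW x1) _.
rewrite lexx x0 subr0 => /(_ isT) H1.
have {}H1 : tail_integral (profile_ext w t) 0 - tail_integral (profile_ext w t) x
    <= w 0 t * x.
  apply: H1 => z /andP[z0 zx]; rewrite /profile_ext (lt_trans zx x1).
  by apply: Wn; rewrite ?lexx ?(lt_trans zx x1).
have := @tail_integralB_ge R _ 0 x (w x t) iW _ (ltW x1) _.
rewrite lexx x0 subr0 => /(_ isT) H2.
have {}H2 : w x t * x <= tail_integral (profile_ext w t) 0 - tail_integral (profile_ext w t) x.
  apply: H2 => z /andP[z0 zx]; rewrite /profile_ext (lt_trans zx x1).
  by apply: Wn; rewrite // z0 ltW.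
rewrite (solution_mass hs t0) in H1 H2; apply/andP; split; lra.
Qed.

(** * Bounds on kappa in terms of w(0, t) *)

Lemma profile_affine_continuous (R : realType) (U : R -> R) (y : R) :
  {within `[0, 1], continuous U} -> 0 <= y < 1 ->
  {within `[0, 1], continuous (fun x => U (y + (1 - y) * x))}.
Proof.
move=> cU /andP[y0 y1]; apply: (continuous_within_comp_in _ _ cU); first by cont.
move=> x /=; rewrite !in_itv/= => /andP[x0 x1].
have H1 : 0 <= (1 - y) * x by rewrite mulr_ge0// subr_ge0 ltW.
have H2 : (1 - y) * x <= 1 - y by rewrite ler_piMr// subr_ge0 ltW.
by apply/andP; split; lra.
Qed.

Lemma affine_unit (R : realType) (y x : R) : 0 <= y < 1 -> 0 <= x < 1 ->
  0 <= y + (1 - y) * x < 1.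
Proof.
move=> /andP[y0 y1] /andP[x0 x1].
have H1 : 0 <= (1 - y) * x by rewrite mulr_ge0// subr_ge0 ltW.
have H2 : (1 - y) * x < 1 - y by rewrite gtr_pMr// subr_gt0.
by apply/andP; split; lra.
Qed.

(** The unit mass at time t + d is the integral of e^d w(X(t), t). Replacing X(t) by the larger
    affine value decreases the integrand, and the change of variables turns the result into e^d/(1 -
    y) times the mass beyond y at time t. *)
Lemma transport_mass_le (R : realType) (phi psi c0 kappa : R -> R)
    (al A B L t d y : R) (w : R -> R -> R) :
  drift_bounds phi psi al A B L -> initial_density c0 ->
  solution phi psi (tail_integral c0) kappa w -> 0 <= t -> 0 <= d -> 0 <= y < 1 ->
  (forall x X, 0 <= x < 1 -> characteristic phi psi kappa x (t + d) X ->
    X t <= y + (1 - y) * x) ->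
  expR d * tail_integral (profile_ext w t) y <= 1 - y.
Proof.
move=> db hi hs t0 d0 y01 HX; have td0 : 0 <= t + d by rewrite addr_ge0.
have cW := solution_continuous db hi hs t0.
have cWa := profile_affine_continuous cW y01.
have iWa := within_continuous_integrable cWa.
have iW' := within_continuous_integrable (solution_continuous db hi hs td0).
rewrite -tail_integral_affine// mulrCA -tail_integralZ//.
case/andP: (y01) => y0 y1.
rewrite ler_piMr ?subr_ge0 ?(ltW y1)// -[leRHS](solution_mass hs td0).
apply: le_tail_integral => //.
  by apply: within_continuous_integrable; apply: within_continuousM => //; exact: within_continuous_cst.
move=> z z01; have zz := affine_unit y01 z01.
have [X hX] := solution_characteristic hs z01 td0.
have st : 0 <= t <= t + d by rewrite t0 lerDl.
rewrite /profile_ext; case/andP: (zz) => zz0 ->; case/andP: (z01) => z0 ->.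
rewrite (solution_transport db hs z01 st hX).
rewrite (_ : t + d - t = d); last by ring.
rewrite ler_pM2l ?expR_gt0//.
have [/(_ t st)/andP[Xt0 _] _ _ _] := hX.
apply: (solution_noninc db hi hs) => //; last by case/andP: zz.
by rewrite Xt0 HX.
Qed.

Lemma transport_mass_ge (R : realType) (phi psi c0 kappa : R -> R)
    (al A B L t d y : R) (w : R -> R -> R) :
  drift_bounds phi psi al A B L -> initial_density c0 ->
  solution phi psi (tail_integral c0) kappa w -> 0 <= t -> 0 <= d -> 0 <= y < 1 ->
  (forall x X, 0 <= x < 1 -> characteristic phi psi kappa x (t + d) X ->
    y + (1 - y) * x <= X t) ->
  1 - y <= expR d * tail_integral (profile_ext w t) y.
Proof.
move=> db hi hs t0 d0 y01 HX; have td0 : 0 <= t + d by rewrite addr_ge0.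
have [ck kp _ _] := hs.
have cW := solution_continuous db hi hs t0.
have cWa := profile_affine_continuous cW y01.
have iWa := within_continuous_integrable cWa.
have iW' := within_continuous_integrable (solution_continuous db hi hs td0).
rewrite -tail_integral_affine// mulrCA -tail_integralZ//.
case/andP: (y01) => y0 y1.
rewrite ler_peMr ?subr_ge0 ?(ltW y1)// -[leLHS](solution_mass hs td0).
apply: le_tail_integral => //.
  by apply: within_continuous_integrable; apply: within_continuousM => //; exact: within_continuous_cst.
move=> z z01; have zz := affine_unit y01 z01.
have [X hX] := solution_characteristic hs z01 td0.
have st : 0 <= t <= t + d by rewrite t0 lerDl.
rewrite /profile_ext; case/andP: (zz) => zz0 ->; case/andP: (z01) => z0 z1; rewrite z1.
rewrite (solution_transport db hs z01 st hX).
rewrite (_ : t + d - t = d); last by ring.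
rewrite ler_pM2l ?expR_gt0//.
apply: (solution_noninc db hi hs) => //; last exact: characteristic_lt1 db ck kp hX z1 _ st.
by rewrite zz0 HX.
Qed.

Lemma kappa_right (R : realType) (kappa : R -> R) (t : R) :
  {within `[0, +oo[%classic, continuous kappa} -> 0 <= t ->
  kappa s @[s --> t^'+] --> kappa t.
Proof.
move=> ck t0; apply: (@within_continuous_right _ _ 0 (t + 1)).
  exact: within_ray_segment.
by rewrite t0 ltrDl ltr01.
Qed.

(* Both bounds on kappa are by contradiction: a violated bound is violated with a
   margin on some [t, t + d], during which the total mass would have to change. *)
Lemma kappa_lower (R : realType) (phi psi c0 kappa : R -> R)
    (al A B L t : R) (w : R -> R -> R) :
  drift_bounds phi psi al A B L -> initial_density c0 ->
  solution phi psi (tail_integral c0) kappa w -> 0 <= t ->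
  1 <= kappa t * (B * w 0 t).
Proof.
move=> db hi hs t0; have [ck kp _ _] := hs.
rewrite leNgt; apply/negP => lt1.
have B0 := db_B db.
have z01 : (0 : R) <= (0 : R) < 1 by rewrite lexx ltr01.
have w00 : 0 < w 0 t := solution_gt0 db hi hs z01 t0.
have Bw0 : 0 <= B * w 0 t by rewrite mulr_ge0// ltW.
have kBw0 : 0 <= kappa t * (B * w 0 t) by rewrite mulr_ge0// ltW// kp.
pose m := (1 + kappa t * (B * w 0 t)) / 2.
have m0 : 0 < m by rewrite /m; lra.
have m1 : m < 1 by rewrite /m; lra.
have near1 : \forall s \near t^'+, kappa s * (B * w 0 t) < m.
  have cv : kappa s * (B * w 0 t) @[s --> t^'+] --> kappa t * (B * w 0 t).
    by apply: cvgM; [exact: kappa_right|exact: cvg_cst].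
  by apply: (cvgr_lt _ cv); rewrite /m; lra.
case: near1 => r /= r0 Hr.
pose d := Num.min (r / 2) ((1 - m) / 2).
have d0 : 0 < d by rewrite lt_min !divr_gt0// subr_gt0.
have dr : d <= r / 2 by rewrite ge_min lexx.
have dm : d <= (1 - m) / 2 by rewrite ge_min lexx orbT.
have r0' : 0 < r by exact: r0.
have td0 : 0 <= t + d by rewrite addr_ge0// ltW.
have st : 0 <= t <= t + d by rewrite t0 lerDl ltW.
(* What lies below [Y t] at time t leaves through 0 before t + d. That mass is at most w(0, t) Y(t)
   <= m d, too little to offset the growth factor e^d. *)
have [Y hY] := solution_characteristic hs z01 td0.
have [Y01 cY dY Ytd] := hY.
have Y1 : Y t < 1 := characteristic_lt1 db ck kp hY ltr01 st.
have /andP[Y0 _] := Y01 t st.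
have Yt01 : 0 <= Y t < 1 by rewrite Y0.
have Ysmall : w 0 t * Y t <= m * d.
  have sub : `[t, t + d] `<=` `[0, t + d] by apply: subset_itvr; rewrite bnd_simp.
  have cY' := continuous_subspaceW sub cY.
  have := @derive_le0_le R (fun s => - (w 0 t * Y s + m * s))
    (fun s => - (w 0 t * (phi (Y s) - kappa s * psi (Y s)) + m)) t (t + d).
  rewrite Ytd mulr0 add0r; move=> H; suff : - (m * (t + d)) <= - (w 0 t * Y t + m * t) by lra.
  apply: H; first by rewrite lerDl ltW.
  - by cont.
  - move=> s /andP[ts std]; have dYs := dY s; rewrite (le_lt_trans t0 ts) std in dYs.
    have {}dYs := dYs isT; der_eq; rewrite /=; ring.
  - move=> s /andP[ts std]; have s0 := le_lt_trans t0 ts.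
    have s0td : 0 <= s <= t + d by rewrite !ltW.
    have Ys := Y01 s s0td; have P := db_phi_ge0 db Ys; have Q := db_psi_le db Ys.
    have /andP[Ys0 Ys1] := Ys.
    have Hs : kappa s * (B * w 0 t) < m.
      by apply: (Hr s _ ts); rewrite /= distrC gtr0_norm ?subr_gt0//; lra.
    have ks := kp s (ltW s0).
    have H1 : kappa s * w 0 t * psi (Y s) <= kappa s * w 0 t * B.
      rewrite ler_pM2l ?mulr_gt0//; apply: (le_trans Q).
      by rewrite ler_piMr//; lra.
    have H2 : 0 <= w 0 t * phi (Y s) by rewrite mulr_ge0// ltW.
    lra.
have := transport_mass_le db hi hs t0 (ltW d0) Yt01.
have HX x X : 0 <= x < 1 -> characteristic phi psi kappa x (t + d) X ->
    X t <= Y t + (1 - Y t) * x.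
  move=> /andP[x0 x1] hX.
  have X1 := characteristic_lt1 db ck kp hX x1 st.
  have := characteristic_ln_ratio db ck kp hY hX x0 x1 st.
  rewrite subr0 ln1 subr0 lerBrDr -lnM ?posrE ?subr_gt0//.
  by rewrite ler_ln ?posrE ?mulr_gt0 ?subr_gt0//; lra.
move=> /(_ HX) Hmass.
have /andP[Hm _] := solution_mass_ge db hi hs Yt01 t0.
have : expR d * (1 - w 0 t * Y t) <= expR d * tail_integral (profile_ext w t) (Y t).
  by rewrite ler_pM2l ?expR_gt0.
have : (1 + d) * (1 - w 0 t * Y t) <= expR d * (1 - w 0 t * Y t).
  rewrite ler_wpM2r ?expR_ge1Dx//.
  have : m * d <= 1 * 1 by apply: ler_pM; lra.
  lra.
have : (1 + d) * (1 - m * d) <= (1 + d) * (1 - w 0 t * Y t).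
  by rewrite ler_wpM2l//; lra.
have H1 : (1 + d) * (1 - m * d) = 1 + d * (1 - m - m * d) by ring.
have : 0 < d * (1 - m - m * d).
  rewrite mulr_gt0//; have : m * d <= 1 * d by rewrite ler_wpM2r//; lra.
  lra.
lra.
Qed.

Lemma kappa_upper (R : realType) (phi psi c0 kappa : R -> R)
    (al A B L t : R) (w : R -> R -> R) :
  drift_bounds phi psi al A B L -> initial_density c0 ->
  solution phi psi (tail_integral c0) kappa w -> 0 <= t -> 1 < w 0 t ->
  (kappa t * al - A) * (w 0 t - 1) <= 1.
Proof.
move=> db hi hs t0 w1; have [ck kp _ _] := hs.
rewrite leNgt; apply/negP => gt1.
have al0 := db_al db.
(* A rate strictly between 1/(w(0, t) - 1) and kappa al - A, so that both strict inequalities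
   survive small changes of time and position. *)
pose k := ((kappa t * al - A) + (w 0 t - 1)^-1) / 2.
have w1' : 0 < w 0 t - 1 by rewrite subr_gt0.
have i0 : 0 < (w 0 t - 1)^-1 by rewrite invr_gt0.
have ik : (w 0 t - 1)^-1 < kappa t * al - A by rewrite -[ltLHS]mul1r ltr_pdivrMr.
have k0 : 0 < k by rewrite /k; lra.
have kk : k < kappa t * al - A by rewrite /k; lra.
have kw : 1 < k * (w 0 t - 1) by rewrite -ltr_pdivrMr// div1r /k; lra.
have near1 : \forall s \near t^'+, k < kappa s * al - A.
  have cv : kappa s * al - A @[s --> t^'+] --> kappa t * al - A.
    apply: cvgB; last exact: cvg_cst.
    by apply: cvgM; [exact: kappa_right|exact: cvg_cst].
  exact: (cvgr_gt _ cv).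
(* The mass on [0, y[ is bounded below through w(y, t), so the inequality at 0 must persist at small
   y. *)
have near2 : \forall y \near 0^'+, 1 < k * (profile_ext w t y - 1).
  have cv : k * (profile_ext w t y - 1) @[y --> 0^'+] --> k * (profile_ext w t 0 - 1).
    apply: cvgM; first exact: cvg_cst.
    apply: cvgB; last exact: cvg_cst.
    apply: (within_continuous_right (solution_continuous db hi hs t0)).
    by rewrite lexx ltr01.
  by apply: (cvgr_gt _ cv); rewrite /profile_ext ltr01.
case: near1 => r /= r0 Hr; case: near2 => e /= e0 He.
have r0' : 0 < r by exact: r0.
have e0' : 0 < e by exact: e0.
pose d := Num.min (r / 2) (e / (2 * k)).
have d0 : 0 < d by rewrite lt_min !divr_gt0// mulr_gt0.
have dr : d <= r / 2 by rewrite ge_min lexx.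
have de : k * d <= e / 2.
  have : d <= e / (2 * k) by rewrite ge_min lexx orbT.
  rewrite ler_pdivlMr ?mulr_gt0//; lra.
(* Gaps grow at rate at least k on [t, t + d]; tracing back shrinks them at least by e^{-k d}, which
   is the backward flow lying above the affine map with this y. *)
pose y := 1 - expR (- (k * d)).
have lt1 : expR (- (k * d)) < 1 by rewrite -expR0 ltr_expR oppr_lt0 mulr_gt0.
have lg0 : 0 < expR (- (k * d)) by exact: expR_gt0.
have y0 : 0 < y by rewrite /y; lra.
have y1 : y < 1 by rewrite /y; lra.
have y01 : 0 <= y < 1 by rewrite (ltW y0) y1.
have ye : y < e by have := @expR_ge1Dx R (- (k * d)); rewrite /y; lra.
have Wy : 1 < k * (w y t - 1).
  have := He y; rewrite /= sub0r normrN gtr0_norm// => /(_ ye y0).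
  by rewrite /profile_ext y1.
have := transport_mass_ge db hi hs t0 (ltW d0) y01.
have HX x X : 0 <= x < 1 -> characteristic phi psi kappa x (t + d) X ->
    y + (1 - y) * x <= X t.
  move=> /andP[x0 x1] hX; have [X01 cX dX Xtd] := hX.
  have sub : `[t, t + d] `<=` `[0, t + d] by apply: subset_itvr; rewrite bnd_simp.
  have cX' := continuous_subspaceW sub cX.
  have := @derive_le0_le R (fun s => - ((1 - X s) * expR (- (k * s))))
    (fun s => - (expR (- (k * s)) * ((kappa s * psi (X s) - phi (X s)) - k * (1 - X s)))) t (t + d).
  rewrite Xtd => H.
  have {}H : - ((1 - x) * expR (- (k * (t + d)))) <= - ((1 - X t) * expR (- (k * t))).
    apply: H; first by rewrite lerDl ltW.
    - by cont.
    - move=> s /andP[ts std]; have dXs := dX s; rewrite (le_lt_trans t0 ts) std in dXs.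
      have {}dXs := dXs isT; der_eq; rewrite /=; ring.
    - move=> s /andP[ts std]; have s0 := le_lt_trans t0 ts.
      have s0td : 0 <= s <= t + d by rewrite !ltW.
      have Xs := X01 s s0td.
      have P := db_phi_incr db Xs (lexx 1).
      have Q := db_psi_incr db Xs (lexx 1).
      rewrite (db_phi1 db) in P; rewrite (db_psi1 db) in Q.
      have /andP[Xs0 Xs1] := Xs.
      have Hs : k < kappa s * al - A.
        by apply: (Hr s _ ts); rewrite /= distrC gtr0_norm ?subr_gt0//; lra.
      have ks := kp s (ltW s0).
      have H1 : kappa s * (al * (1 - X s)) <= kappa s * psi (X s).
        by rewrite ler_pM2l//; lra.
      have H2 : k * (1 - X s) <= (kappa s * al - A) * (1 - X s).
        by rewrite ler_wpM2r ?subr_ge0// ltW.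
      rewrite oppr_le0 mulr_ge0 ?expR_ge0//; lra.
  move: H; rewrite lerN2 (_ : - (k * (t + d)) = - (k * t) + - (k * d)); last by ring.
  rewrite expRD => H; have : 1 - X t <= (1 - x) * expR (- (k * d)).
    by rewrite -(ler_pM2r (expR_gt0 (- (k * t)))); lra.
  rewrite /y; lra.
move=> /(_ HX) Hmass.
have /andP[_ Hm] := solution_mass_ge db hi hs y01 t0.
have ed : (1 - d) * expR d <= 1.
  have := @expR_ge1Dx R (- d); rewrite -(ler_pM2r (expR_gt0 d)) -expRD addNr expR0.
  by [].
have M1 : 1 - y <= expR d * (1 - w y t * y).
  by apply: (le_trans Hmass); rewrite ler_pM2l ?expR_gt0.
have M1' : 0 <= 1 - w y t * y.
  by rewrite -(pmulr_rge0 _ (expR_gt0 d)); apply: le_trans M1; rewrite subr_ge0 ltW.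
have M2 : (1 - d) * (1 - y) <= 1 - w y t * y.
  have [d1|d1] := leP d 1; last first.
    by apply: le_trans M1'; rewrite mulr_le0_ge0 ?subr_ge0 ?subr_le0 ?(ltW y1) ?(ltW d1).
  apply: (@le_trans _ _ ((1 - d) * (expR d * (1 - w y t * y)))).
    by rewrite ler_wpM2l// subr_ge0.
  by rewrite mulrA ler_piMl.
(* This is k d <= e^{k d} - 1. Together with [M4] it yields k (w(y, t) - 1) <= 1, contradicting
   [Wy]. *)
have M3 : k * d * (1 - y) <= y.
  have := @expR_ge1Dx R (k * d).
  rewrite -(ler_pM2r lg0) -expRD subrr expR0 /y; lra.
have M4 : y * (w y t - 1) <= d * (1 - y) by lra.
have wy1 : 0 < w y t - 1 by rewrite -(pmulr_rgt0 _ k0) (lt_trans ltr01).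
have M5 : k * d * (1 - y) * (w y t - 1) <= d * (1 - y).
  by apply: le_trans M4; rewrite ler_pM2r.
have : d * (1 - y) < d * (1 - y) * (k * (w y t - 1)).
  by rewrite ltr_pMr// mulr_gt0// subr_gt0.
lra.
Qed.

(** * Uniform bounds on w(0, t) *)

Lemma solution_origin_ge1 (R : realType) (phi psi c0 kappa : R -> R)
    (al A B L t : R) (w : R -> R -> R) :
  drift_bounds phi psi al A B L -> initial_density c0 ->
  solution phi psi (tail_integral c0) kappa w -> 0 <= t -> 1 <= w 0 t.
Proof.
move=> db hi hs t0; have z01 : (0 : R) <= (0 : R) < 1 by rewrite lexx ltr01.
by have := solution_mass_le db hi hs z01 t0; rewrite mulr0 add0r subr0 mulr1.
Qed.

Lemma solution_ln (R : realType) (phi psi c0 kappa : R -> R)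
    (al A B L x t : R) (w : R -> R -> R) (X : R -> R) :
  drift_bounds phi psi al A B L -> initial_density c0 ->
  solution phi psi (tail_integral c0) kappa w ->
  0 <= x < 1 -> 0 <= t -> characteristic phi psi kappa x t X ->
  0 <= X 0 < 1 /\ ln (w x t) = t + ln (tail_integral c0 (X 0)).
Proof.
move=> db hi hs x01 t0 hX; have [ck kp _ _] := hs.
have H00 : (0 : R) <= 0 <= t by rewrite lexx.
have X01 : 0 <= X 0 < 1.
  case/andP: x01 => x0 x1; rewrite (characteristic_lt1 db ck kp hX x1 H00) andbT.
  by have [/(_ 0 H00)/andP[]] := hX.
split=> //; rewrite (solution_along db hs x01 t0 hX) lnM ?posrE ?expR_gt0//.
  by rewrite expRK.
exact: initial_profile_gt0.
Qed.

(** The characteristics ending at 0 and at 1/2 have gaps at time 0 with quotient at least 1/2, so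
    w(0, t) exceeds w(1/2, t) at most by the factor e^{C0 + q ln 2}; and w(1/2, t) <= 2 because the
    mass is 1. *)
Lemma solution_origin_le (R : realType) (phi psi c0 kappa : R -> R)
    (al A B L q C0 t : R) (w : R -> R -> R) :
  drift_bounds phi psi al A B L -> initial_density c0 -> 0 <= q ->
  (forall y z, 0 <= y <= z -> z < 1 -> q * (ln (1 - z) - ln (1 - y)) - C0 <=
    ln (tail_integral c0 z) - ln (tail_integral c0 y)) ->
  solution phi psi (tail_integral c0) kappa w -> 0 <= t ->
  w 0 t <= 2 * expR (C0 + q * ln 2).
Proof.
move=> db hi q0 H hs t0; have [ck kp _ _] := hs.
have z01 : (0 : R) <= (0 : R) < 1 by rewrite lexx ltr01.
have h01 : 0 <= (1 / 2 : R) < 1 by apply/andP; split; lra.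
have H00 : (0 : R) <= 0 <= t by rewrite lexx.
have [Y hY] := solution_characteristic hs z01 t0.
have [X hX] := solution_characteristic hs h01 t0.
have [Y01 lnY] := solution_ln db hi hs z01 t0 hY.
have [X01 lnX] := solution_ln db hi hs h01 t0 hX.
have h0 : (0 : R) <= 1 / 2 by case/andP: h01.
have h1 : (1 / 2 : R) < 1 by case/andP: h01.
have YX := characteristic_mono db kp hY hX h0 H00.
have rat := characteristic_ln_ratio db ck kp hY hX h0 h1 H00.
have := H (Y 0) (X 0); rewrite YX andbT => HYX.
have {}HYX := HYX _ _; case/andP: Y01 => Y0 Y1; case/andP: X01 => X0 X1.
have {}HYX := HYX Y0 X1.
rewrite subr0 ln1 subr0 in rat.
have E2 : ln (1 - 1 / 2) = - ln 2 :> R.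
  by rewrite (_ : 1 - 1 / 2 = 2^-1 :> R) ?lnV ?posrE//; lra.
rewrite E2 in rat.
have H2 : q * (- ln 2) <= q * (ln (1 - X 0) - ln (1 - Y 0)) by rewrite ler_wpM2l.
have wh := solution_gt0 db hi hs h01 t0.
have w0 := solution_gt0 db hi hs z01 t0.
have H3 : ln (w 0 t) <= ln (w (1 / 2) t * expR (C0 + q * ln 2)).
  by rewrite lnM ?posrE ?expR_gt0// expRK lnY lnX; lra.
rewrite ler_ln ?posrE ?mulr_gt0 ?expR_gt0// in H3.
apply: (le_trans H3); rewrite ler_pM2r ?expR_gt0//.
have /andP[_ U] := solution_mass_ge db hi hs h01 t0.
have V : 0 <= tail_integral (profile_ext w t) (1 / 2).
  apply: Rintegral_ge0 => z /=; rewrite in_itv/= => /andP[z2 z1].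
  rewrite /profile_ext z1; apply/ltW/(solution_gt0 db hi hs) => //.
  by rewrite z1 (le_trans h0).
lra.
Qed.

(** Compare w(0, .) at times s and t: 1 <= w(0, s) and w(0, t) <= CU force ln w_0 to differ by at
    most ln CU - (t - s) between the two feet. The lower bound on ln w_0 converts this into a small
    gap quotient at time 0, and convexity of F(., s) carries it to 1 - Y(s). A characteristic ending
    at x >= 0 has a smaller gap still. *)
Lemma characteristic_decay (R : realType) (phi psi c0 kappa : R -> R)
    (al A B L q C0 CU x t : R) (w : R -> R -> R) (X : R -> R) :
  drift_bounds phi psi al A B L -> initial_density c0 -> 0 < q ->
  (forall y z, 0 <= y <= z -> z < 1 -> q * (ln (1 - z) - ln (1 - y)) - C0 <=
    ln (tail_integral c0 z) - ln (tail_integral c0 y)) ->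
  solution phi psi (tail_integral c0) kappa w -> 0 <= t -> w 0 t <= CU ->
  0 <= x < 1 -> characteristic phi psi kappa x t X ->
  forall s, 0 <= s <= t ->
  1 - X s <= expR ((C0 + ln CU) / q) * expR (- (q^-1 * (t - s))).
Proof.
move=> db hi q0 H hs t0 wCU /andP[x0 x1] hX s /[dup] s0t /andP[s0 st].
have [ck kp _ _] := hs.
have z01 : (0 : R) <= (0 : R) < 1 by rewrite lexx ltr01.
have H00 : (0 : R) <= 0 <= t by rewrite lexx.
have H00s : (0 : R) <= 0 <= s by rewrite lexx.
have [Y hY] := solution_characteristic hs z01 t0.
have [Z hZ] := solution_characteristic hs z01 s0.
have [/andP[Y0 Y1] lnY] := solution_ln db hi hs z01 t0 hY.
have [/andP[Z0 Z1] lnZ] := solution_ln db hi hs z01 s0 hZ.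
have YX := characteristic_mono db kp hY hX x0 s0t.
apply: (@le_trans _ _ (1 - Y s)); first by rewrite lerD2l lerN2.
have Ys1 := characteristic_lt1 db ck kp hY ltr01 s0t.
have Ys0 : 0 <= Y s by have [/(_ s s0t)/andP[]] := hY.
have hYs := characteristic_restrict hY s0t.
have ZY := characteristic_mono db kp hZ hYs Ys0 H00s.
have rat := characteristic_ln_ratio db ck kp hZ hYs Ys0 Ys1 H00s.
rewrite subr0 ln1 subr0 in rat.
have := H (Z 0) (Y 0); rewrite ZY Z0 => /(_ isT Y1) HZY.
have w0 := solution_gt0 db hi hs z01 t0.
have L1 : ln (w 0 t) <= ln CU by rewrite ler_ln ?posrE//; apply: lt_le_trans wCU.
have L2 : 0 <= ln (w 0 s) by rewrite ln_ge0// (solution_origin_ge1 db hi hs s0).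
have L3 : q * ln (1 - Y s) <= q * (ln (1 - Y 0) - ln (1 - Z 0)).
  by rewrite ler_pM2l.
rewrite -expRD -[leLHS]lnK ?posrE ?subr_gt0// ler_expR -(ler_pM2l q0).
have -> : q * ((C0 + ln CU) / q + - (q^-1 * (t - s))) = C0 + ln CU - (t - s).
  by field; rewrite gt_eqF.
lra.
Qed.

Lemma initial_profile_left1 (R : realType) (c0 : R -> R) (e : R) :
  initial_density c0 -> 0 < e ->
  exists2 d, 0 < d < 1 & tail_integral c0 (1 - d) <= e.
Proof.
move=> hi e0; have cv : tail_integral c0 x @[x --> 1^'-] --> tail_integral c0 1.
  apply: (within_continuous_left (initial_profile_continuous hi)).
  by rewrite ltr01 lexx.
rewrite tail_integral1 in cv.
have near1 : \forall x \near 1^'-, tail_integral c0 x < e by exact: (cvgr_lt _ cv).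
case: near1 => r /= r0' Hr; have r0 : 0 < r := r0'.
have m0 : 0 < Num.min r 1 by rewrite lt_min r0 ltr01.
have mr : Num.min r 1 <= r by rewrite ge_min lexx.
have m1 : Num.min r 1 <= 1 by rewrite ge_min lexx orbT.
exists (Num.min r 1 / 2); first by apply/andP; split; lra.
apply/ltW/Hr; last by lra.
by rewrite /= opprB addrCA subrr addr0 gtr0_norm; lra.
Qed.

(** Up to time T the gap grows backward at most by e^{A T}, so the foot of 1 - h stays within d of
    1, where e^T w_0 <= 1/2. A profile that is at most 1/2 on [1 - h, 1[ must exceed 1 elsewhere by
    mass conservation. *)
Lemma origin_gap_early (R : realType) (phi psi c0 : R -> R)
    (al A B L T : R) :
  drift_bounds phi psi al A B L -> initial_density c0 -> 0 <= T ->
  exists2 d, 0 < d & forall (kappa : R -> R) (w : R -> R -> R),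
    solution phi psi (tail_integral c0) kappa w ->
    forall t, 0 <= t <= T -> 1 + d <= w 0 t.
Proof.
move=> db hi T0; have A0 := db_A db.
have e0 : 0 < expR (- T) / 2 by rewrite divr_gt0 ?expR_gt0.
have [d /andP[d0 d1] Hd] := initial_profile_left1 hi e0.
pose h := d * expR (- (A * T)).
have E1 : expR (- (A * T)) <= 1 by rewrite -expR0 ler_expR oppr_le0 mulr_ge0.
have h0 : 0 < h by rewrite mulr_gt0 ?expR_gt0.
have hd : h <= d by rewrite /h ler_piMr// ltW.
exists (h / 2); first by rewrite divr_gt0.
move=> kappa w hs t /andP[t0 tT]; have [ck kp _ _] := hs.
have H00 : (0 : R) <= 0 <= t by rewrite lexx.
have x01 : 0 <= 1 - h < 1 by apply/andP; split; lra.
have [X hX] := solution_characteristic hs x01 t0.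
have [/andP[X0 X1] _] := solution_ln db hi hs x01 t0 hX.
have := characteristic_gap_le db kp hX H00.
rewrite subr0 (_ : 1 - (1 - h) = h); last by ring.
move=> gap.
have : expR (A * t) * h <= d.
  rewrite /h mulrCA -expRD ler_piMr ?(ltW d0)// -expR0 ler_expR.
  by rewrite subr_le0 ler_wpM2l.
move=> gapd.
have Xd : tail_integral c0 (X 0) <= expR (- T) / 2.
  apply: le_trans Hd; apply: initial_profile_noninc => //; last exact: ltW.
  by apply/andP; split; lra.
have wx : w (1 - h) t <= 1 / 2.
  rewrite (solution_along db hs x01 t0 hX).
  apply: (@le_trans _ _ (expR T * (expR (- T) / 2))).
    apply: ler_pM; rewrite ?expR_ge0 ?ler_expR//.
    by apply/ltW/initial_profile_gt0; rewrite ?X0.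
  by rewrite mulrA -expRD subrr expR0.
have M := solution_mass_le db hi hs x01 t0.
have w1 := solution_origin_ge1 db hi hs t0.
have : w (1 - h) t * (1 - (1 - h)) <= 1 / 2 * (1 - (1 - h)).
  by rewrite ler_wpM2r//; lra.
have : 1 * h <= w 0 t * h by rewrite ler_pM2r.
lra.
Qed.

Lemma origin_gap_late (R : realType) (phi psi c0 : R -> R)
    (al A B L q C0 CU p a : R) :
  drift_bounds phi psi al A B L -> initial_density c0 -> 0 < q -> 1 <= CU ->
  (forall y z, 0 <= y <= z -> z < 1 -> q * (ln (1 - z) - ln (1 - y)) - C0 <=
    ln (tail_integral c0 z) - ln (tail_integral c0 y)) ->
  (forall (kappa : R -> R) (w : R -> R -> R),
    solution phi psi (tail_integral c0) kappa w ->
    forall t, 0 <= t -> w 0 t <= CU) ->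
  0 < p -> 0 <= a < 1 ->
  (forall y z, a <= y <= z -> z < 1 ->
    ln (tail_integral c0 z) - ln (tail_integral c0 y) <=
    p * (ln (1 - z) - ln (1 - y))) ->
  exists T d, [/\ 0 <= T, 0 < d & forall (kappa : R -> R) (w : R -> R -> R),
    solution phi psi (tail_integral c0) kappa w ->
    forall t, T <= t -> 1 + d <= w 0 t].
Proof.
move=> db hi q0 CU1 Hq HCU p0 a01 Hp.
have A0 := db_A db; have L0 := db_L db; have al0 := db_al db.
have lnCU : 0 <= ln CU by rewrite ln_ge0.
have wa := initial_profile_gt0 hi a01.
pose C := expR ((C0 + ln CU) / q).
have C_gt0 : 0 < C by exact: expR_gt0.
(* characteristics ending within [eta] of 1 stay in [1/2, 1]: up to time [tau]
   before the end by the linear growth bound, earlier by the decay bound *)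
pose tau := q * (ln (2 * C)).
pose eta := expR (- (A * `|tau|)) / 2.
have E1 : expR (- (A * `|tau|)) <= 1 by rewrite -expR0 ler_expR oppr_le0 mulr_ge0.
have E0 : 0 < expR (- (A * `|tau|)) by exact: expR_gt0.
have eta0 : 0 < eta by rewrite /eta; lra.
have eta1 : eta <= 1 / 2 by rewrite /eta; lra.
pose M := al^-1 + (A / al + 1) * C / q^-1.
have M0 : 0 <= M.
  rewrite addr_ge0 ?invr_ge0 ?(ltW al0)// divr_ge0 ?invr_ge0 ?(ltW q0)//.
  by rewrite mulr_ge0 ?(ltW C_gt0)// addr_ge0// divr_ge0// ltW.
pose theta := expR (- (L * M)).
have th0 : 0 < theta by exact: expR_gt0.
(* r = (1 + theta)^{-p} is the guaranteed decrease of w from 1 - eta to 1 - eta/2: the relative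
   spread is 1 at time t, hence at least theta at time 0, where w_0 decreases at least like the
   power p of the gap. *)
pose r := expR (- (p * ln (1 + theta))).
have r1 : r < 1.
  by rewrite -expR0 ltr_expR oppr_lt0 mulr_gt0// ln_gt0// ltrDl.
have r0 : 0 < r by exact: expR_gt0.
exists (`|ln CU - ln (tail_integral c0 a)| + 1), ((1 - r) * (eta / 2)); split.
- by rewrite addr_ge0.
- by rewrite mulr_gt0 ?subr_gt0// divr_gt0.
move=> kappa w hs t Tt.
have N := ler_norm (ln CU - ln (tail_integral c0 a)).
have N0 := normr_ge0 (ln CU - ln (tail_integral c0 a)).
have t0 : 0 <= t by lra.
have [ck kp _ _] := hs.
have H00 : (0 : R) <= 0 <= t by rewrite lexx.
have z01 : (0 : R) <= (0 : R) < 1 by rewrite lexx ltr01.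
have x01 : 0 <= 1 - eta < 1 by apply/andP; split; lra.
have y01 : 0 <= 1 - eta / 2 < 1 by apply/andP; split; lra.
have xy : 1 - eta <= 1 - eta / 2 by lra.
have [Y hY] := solution_characteristic hs z01 t0.
have [X hX] := solution_characteristic hs x01 t0.
have [Z hZ] := solution_characteristic hs y01 t0.
have [/andP[Y0 Y1] lnY] := solution_ln db hi hs z01 t0 hY.
have [/andP[X0 X1] lnX] := solution_ln db hi hs x01 t0 hX.
have [/andP[Z0 Z1] lnZ] := solution_ln db hi hs y01 t0 hZ.
have x0 : 0 <= 1 - eta by case/andP: x01.
have y1 : 1 - eta / 2 < 1 by case/andP: y01.
have YX := characteristic_mono db kp hY hX x0 H00.
have XZ := characteristic_mono db kp hX hZ xy H00.
have wY := solution_gt0 db hi hs z01 t0.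
have wX := solution_gt0 db hi hs x01 t0.
have wZ := solution_gt0 db hi hs y01 t0.
(* This is the role of the late time: a foot below a would give w(0, t) >= e^t w_0(a) > CU. The
   other feet lie further right, inside the range of [Hp]. *)
have aY : a <= Y 0.
  rewrite leNgt; apply/negP => Ya.
  have : ln (tail_integral c0 a) <= ln (tail_integral c0 (Y 0)).
    rewrite ler_ln ?posrE//; last by apply: initial_profile_gt0; rewrite ?Y0.
    by apply: initial_profile_noninc; rewrite ?Y0 ?(ltW Ya)//; case/andP: a01 => _ /ltW.
  have : ln (w 0 t) <= ln CU.
    by rewrite ler_ln ?posrE ?(lt_le_trans ltr01 CU1)//; exact: HCU hs _ t0.
  clear -Tt N lnY; lra.
have dec := characteristic_decay db hi q0 Hq hs t0 (HCU _ _ hs _ t0) x01 hX.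
rewrite -/C in dec.
have X2 s : 0 <= s <= t -> 1 / 2 <= X s.
  move=> /[dup] s0t /andP[s0 st].
  have [ts|ts] := leP (t - s) `|tau|.
    have := characteristic_gap_le db kp hX s0t.
    rewrite (_ : 1 - (1 - eta) = eta); last by ring.
    have : expR (A * (t - s)) * eta <= 1 / 2.
      rewrite /eta mulrA -expRD ler_pM2r ?invr_gt0// -expR0 ler_expR subr_le0.
      by rewrite ler_wpM2l.
    clear; lra.
  have := dec s s0t.
  have : C * expR (- (q^-1 * (t - s))) <= C * expR (- ln (2 * C)).
    rewrite ler_pM2l// ler_expR lerN2 -(ler_pM2l q0) mulrA divff ?gt_eqF// mul1r.
    by rewrite -/tau; apply: (le_trans (ler_norm _)); exact: ltW.
  rewrite -lnV ?posrE ?mulr_gt0// lnK ?posrE ?invr_gt0 ?mulr_gt0//.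
  have -> : C / (2 * C) = 1 / 2 by field; rewrite gt_eqF.
  clear; lra.
have iq0 : 0 < q^-1 by rewrite invr_gt0.
have [E [E' [cE dE bE HM]]] := characteristic_budget db kp hX (ltW C_gt0) iq0 dec.
rewrite -/M in HM.
have := characteristic_spread db ck kp t0 hX hZ xy y1 X2 cE dE bE HM.
have -> : (1 - (1 - eta)) / (1 - (1 - eta / 2)) - 1 = 1.
  rewrite (_ : 1 - (1 - eta) = eta) 1?(_ : 1 - (1 - eta / 2) = eta / 2); [|ring|ring].
  by rewrite invf_div mulrCA divff ?gt_eqF// mulr1; ring.
rewrite mul1r -/theta => spread.
have HpXZ := Hp (X 0) (Z 0); rewrite XZ Z1 (le_trans aY YX) in HpXZ.
have {}HpXZ := HpXZ isT isT.
have Lth : ln (1 + theta) <= ln (1 - X 0) - ln (1 - Z 0).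
  rewrite -ln_div ?posrE ?subr_gt0// ler_ln ?posrE ?divr_gt0 ?subr_gt0 ?addr_gt0//.
  clear -spread; lra.
have pL : p * ln (1 + theta) <= p * (ln (1 - X 0) - ln (1 - Z 0)) by rewrite ler_pM2l.
have wZr : w (1 - eta / 2) t <= r * w 0 t.
  rewrite -ler_ln ?posrE ?mulr_gt0// lnM ?posrE// /r expRK.
  have : ln (w (1 - eta) t) <= ln (w 0 t).
    rewrite ler_ln ?posrE//; apply: (solution_noninc db hi hs) => //.
      by rewrite lexx.
    by case/andP: x01.
  clear -lnX lnZ HpXZ pL; lra.
have Hm := solution_mass_le db hi hs y01 t0.
have w1 := solution_origin_ge1 db hi hs t0.
have K1 : w (1 - eta / 2) t * (1 - (1 - eta / 2)) <= r * w 0 t * (1 - (1 - eta / 2)).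
  by rewrite ler_wpM2r//; clear -eta0; lra.
have K2 : 1 * ((1 - r) * (eta / 2)) <= w 0 t * ((1 - r) * (eta / 2)).
  by rewrite ler_wpM2r// mulr_ge0 ?subr_ge0 ?(ltW r1)//; clear -eta0; lra.
clear -Hm w1 K1 K2; lra.
Qed.

(** * The time average of kappa *)

Lemma kappa_integral_asymptotics (R : realType) (phi psi c0 kappa : R -> R)
    (al A B L q C0 CU beta0 e : R) (w : R -> R -> R) :
  drift_bounds phi psi al A B L -> initial_density c0 -> 0 < q -> 1 <= CU ->
  (forall y z, 0 <= y <= z -> z < 1 -> q * (ln (1 - z) - ln (1 - y)) - C0 <=
    ln (tail_integral c0 z) - ln (tail_integral c0 y)) ->
  solution phi psi (tail_integral c0) kappa w ->
  (forall t, 0 <= t -> w 0 t <= CU) ->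
  0 < beta0 < 1 -> beta c0 (tail_integral c0) x @[x --> 1^'-] --> beta0 -> 0 < e ->
  exists G T0 : R, forall T, T0 <= T -> 0 < T ->
    `|al * (\int[lebesgue_measure]_(s in `[0%R, T]) kappa s) - A * T -
      (beta0^-1 - 1) * T| <= G + e * T.
Proof.
move=> db hi q0 CU1 Hq hs HCU /[dup] hb0 /andP[b0 b1] hb e0.
have A0 := db_A db; have L0 := db_L db; have al0 := db_al db.
have lnCU : 0 <= ln CU by rewrite ln_ge0.
pose p := beta0 / (1 - beta0).
have p0 : 0 < p by rewrite divr_gt0// subr_gt0.
have pV : beta0^-1 - 1 = p^-1.
  by rewrite /p; field; rewrite !gt_eqF// subr_gt0.
rewrite pV.
(* The first term gives p m <= 2 (T + D) for the logarithmic gap m below; the second then makes the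
   error d m at most e p (T + D). *)
pose d := Num.min (p / 2) (e * p ^+ 2 / 2).
have d0 : 0 < d.
  by rewrite lt_min; apply/andP; split; apply: divr_gt0; rewrite // mulr_gt0 ?exprn_gt0.
have dp : d <= p / 2 by rewrite ge_min lexx.
have de : d <= e * p ^+ 2 / 2 by rewrite ge_min lexx orbT.
have [a /[dup] a01 /andP[a0 a1] Ha] := initial_ln_asymptotics hi hb0 d0 hb.
rewrite -/p in Ha.
set C := expR ((C0 + ln CU) / q).
have C_gt0 : 0 < C by exact: expR_gt0.
pose M := al^-1 + (A / al + 1) * C / q^-1.
pose Wa := ln (tail_integral c0 a).
pose D : R := `|Wa| + ln CU.
exists (L * M - ln (1 - a) + (e * D + D / p)), (ln CU - Wa + 1) => T TT T0.
have T0' := ltW T0.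
have [ck kp _ _] := hs.
have H00 : (0 : R) <= 0 <= T by rewrite lexx.
have z01 : (0 : R) <= (0 : R) < 1 by rewrite lexx ltr01.
have [X hX] := solution_characteristic hs z01 T0'.
have [/andP[X0 X1] lnX] := solution_ln db hi hs z01 T0' hX.
have wX := solution_gt0 db hi hs z01 T0'.
have wa := initial_profile_gt0 hi a01.
have lnU : ln (w 0 T) <= ln CU.
  by rewrite ler_ln ?posrE ?(lt_le_trans ltr01 CU1)// HCU.
have lnU0 : 0 <= ln (w 0 T) by rewrite ln_ge0// (solution_origin_ge1 db hi hs T0').
have aX : a <= X 0.
  rewrite leNgt; apply/negP => Xa.
  have : Wa <= ln (tail_integral c0 (X 0)).
    rewrite ler_ln ?posrE//; last by apply: initial_profile_gt0; rewrite ?X0.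
    by apply: initial_profile_noninc; rewrite ?X0 ?(ltW Xa) ?(ltW a1).
  lra.
have dec := characteristic_decay db hi q0 Hq hs T0' (HCU _ T0') z01 hX.
rewrite -/C in dec.
have iq0 : 0 < q^-1 by rewrite invr_gt0.
have [E [E' [cE dE bE HM]]] := characteristic_budget db kp hX (ltW C_gt0) iq0 dec.
rewrite -/M in HM.
have := characteristic_average db ck kp T0 hX ltr01 cE dE bE HM.
rewrite subr0 ln1 sub0r opprK.
set K := Rintegral _ _ _ => /andP[K1 K2].
(* The two-sided comparison of w_0 between a and the foot reads |p m - T| <= d m + D, where D bounds
   the difference of ln w_0(a) and ln w(0, T). *)
pose m := ln (1 - a) - ln (1 - X 0).
have m0 : 0 <= m by rewrite subr_ge0 ler_ln ?posrE ?subr_gt0//; lra.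
have := Ha a (X 0); rewrite lexx aX => /(_ isT X1) /andP[].
rewrite -/Wa (_ : ln (1 - X 0) - ln (1 - a) = - m); last by rewrite /m; ring.
have -> : ln (tail_integral c0 (X 0)) = ln (w 0 T) - T by clear -lnX; lra.
move=> B1 B2.
have NW := ler_norm Wa; have NW' := ler_norm (- Wa); rewrite normrN in NW'.
have D0 : 0 <= D by rewrite addr_ge0.
have DW1 : - D <= Wa - ln (w 0 T) <= D by rewrite /D; apply/andP; split; clear -NW NW' lnU lnU0 lnCU; lra.
have /andP[DW1a DW1b] := DW1.
have dm : d * m <= p / 2 * m by rewrite ler_wpM2r.
have pm : p * m <= 2 * (T + D) by clear -B2 dm DW1b; lra.
have dm2 : d * m <= e * p * (T + D).
  apply: (@le_trans _ _ (e * p ^+ 2 / 2 * m)); first by rewrite ler_wpM2r.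
  rewrite (_ : e * p ^+ 2 / 2 * m = e * p * (p * m / 2)); last by ring.
  have ep := mulr_gt0 e0 p0; rewrite (ler_pM2l ep).
  clear -pm; lra.
have pmT : `|p * m - T| <= e * p * (T + D) + D.
  by rewrite ler_norml; apply/andP; split; clear -B1 B2 dm2 DW1a DW1b; lra.
have mT : `|m - p^-1 * T| <= e * T + (e * D + D / p).
  have -> : m - p^-1 * T = (p * m - T) / p by field; rewrite gt_eqF.
  rewrite normrM normfV (gtr0_norm p0) ler_pdivrMr//.
  rewrite (_ : (e * T + (e * D + D / p)) * p = e * p * (T + D) + D)//.
  by field; rewrite gt_eqF.
have la : 0 <= - ln (1 - a) by rewrite oppr_ge0 ln_le0//; clear -a0; lra.
move: mT; rewrite !ler_norml => /andP[mT1 mT2]; rewrite /m in mT1 mT2.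
have LM0 : 0 <= L * M by clear -K1 K2; lra.
by apply/andP; split; clear -K1 K2 mT1 mT2 la LM0; lra.
Qed.

Theorem theorem1p1 (R : realType) (phi psi c0 : R -> R) (beta0 : R)
    (hcoef : coefficients phi psi)
    (hinit : initial_density c0)
    (hbeta0 : 0 < beta0 < 1)
    (hbeta : beta c0 (tail_integral c0) x @[x --> 1^'-] --> beta0) :
  (exists2 C1 : R, 0 < C1 &
     forall (kappa : R -> R) (w : R -> R -> R),
       solution phi psi (tail_integral c0) kappa w ->
       forall t, 0 <= t -> C1 <= kappa t) /\
  (C_in 3 `]0, 1]%classic phi -> C_in 3 `]0, 1]%classic psi ->
   (forall x, 0 < x <= 1 -> 0 <= deriv_n 3 phi x) ->
   (forall x, 0 < x <= 1 -> deriv_n 3 psi x <= 0) ->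
   (exists2 C2 : R, 0 < C2 &
      forall (kappa : R -> R) (w : R -> R -> R),
        solution phi psi (tail_integral c0) kappa w ->
        forall t, 0 <= t -> kappa t <= C2) /\
   (forall (kappa : R -> R) (w : R -> R -> R),
      solution phi psi (tail_integral c0) kappa w ->
      T^-1 * (\int[lebesgue_measure]_(t in `[0%R, T]) kappa t)
        @[T --> +oo] -->
      (beta0^-1 - deriv_n 1 phi 1 - 1) / `|deriv_n 1 psi 1|)).
Proof.
have [L db] := coefficients_drift_bounds hcoef.
set al := - deriv_n 1 psi 1 in db; set A := - deriv_n 1 phi 1 in db.
have A0 := db_A db; have al0 := db_al db; have B0 := db_B db.
have /andP[b0 b1] := hbeta0.
pose p := beta0 / (1 - beta0).
have p0 : 0 < p by rewrite divr_gt0// subr_gt0.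
have p20 : 0 < p / 2 by rewrite divr_gt0.
(* For the bounds on kappa, any positive exponents on both sides of p suffice; the tolerance p/2
   gives 3p/2 and p/2. The time average uses arbitrarily small tolerances instead. *)
have [a /[dup] a01 /andP[a0 a1] Ha] := initial_ln_asymptotics hinit hbeta0 p20 hbeta.
rewrite -/p in Ha.
pose q := p + p / 2.
have q0 : 0 < q by rewrite addr_gt0.
have Hlow y z : a <= y <= z -> z < 1 -> q * (ln (1 - z) - ln (1 - y)) <=
    ln (tail_integral c0 z) - ln (tail_integral c0 y).
  by move=> yz z1; have /andP[] := Ha y z yz z1.
have Hup y z : a <= y <= z -> z < 1 ->
    ln (tail_integral c0 z) - ln (tail_integral c0 y) <=
    p / 2 * (ln (1 - z) - ln (1 - y)).
  move=> yz z1; have /andP[_] := Ha y z yz z1.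
  by rewrite (_ : p - p / 2 = p / 2)//; field.
have Hq := initial_ln_lower_global hinit (ltW q0) a01 Hlow.
set C0 := ln (tail_integral c0 0) - ln (tail_integral c0 a) in Hq.
have C00 : 0 <= C0.
  rewrite subr_ge0 ler_ln ?posrE; last 2 first.
  - exact: initial_profile_gt0.
  - by apply: initial_profile_gt0; rewrite // lexx ltr01.
  by apply: initial_profile_noninc; rewrite ?lexx ?a0 ?(ltW a1).
pose CU := 2 * expR (C0 + q * ln 2).
have CU1 : 1 <= CU.
  have : 1 <= expR (C0 + q * ln 2).
    rewrite -[leLHS]expR0 ler_expR addr_ge0// mulr_ge0 ?(ltW q0)// ln_ge0//.
    by rewrite ler1n.
  rewrite /CU; lra.
have HCU kappa w : solution phi psi (tail_integral c0) kappa w ->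
    forall t, 0 <= t -> w 0 t <= CU.
  by move=> hs t t0; exact: (solution_origin_le db hinit (ltW q0) Hq hs t0).
split.
  (* Adding 1 makes the denominator positive from psi(0) >= 0 alone. *)
  have P : 0 < psi 0 * CU + 1.
    by rewrite ltr_wpDl// mulr_ge0// (le_trans ler01).
  exists (psi 0 * CU + 1)^-1; first by rewrite invr_gt0.
  move=> kappa w hs t t0; have [_ kp _ _] := hs; have k0 := kp t t0.
  rewrite -[leLHS]mul1r ler_pdivrMr//.
  apply: (le_trans (kappa_lower db hinit hs t0)); rewrite ler_pM2l//.
  have : psi 0 * w 0 t <= psi 0 * CU by rewrite ler_wpM2l// (HCU _ _ hs).
  lra.
move=> _ _ _ _.
have [T [d1 [T0 d10 H1]]] :=
  origin_gap_late db hinit q0 CU1 Hq HCU p20 a01 Hup.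
have [d2 d20 H2] := origin_gap_early db hinit T0.
split.
  pose d := Num.min d1 d2.
  have d0 : 0 < d by rewrite lt_min d10.
  have dd1 : d <= d1 by rewrite ge_min lexx.
  have dd2 : d <= d2 by rewrite ge_min lexx orbT.
  have i0 : 0 < d^-1 by rewrite invr_gt0.
  (* With w(0, t) - 1 >= d at all times, (kappa al - A)(w(0, t) - 1) <= 1 gives kappa al - A <=
     1/d. *)
  exists ((A + d^-1) / al); first by rewrite divr_gt0// ltr_wpDl.
  move=> kappa w hs t t0.
  have wd : 1 + d <= w 0 t.
    have [Tt|/ltW tT] := leP T t; first by have := H1 _ _ hs t Tt; lra.
    by have := H2 _ _ hs t; rewrite t0 tT => /(_ isT); lra.
  have w1 : 1 < w 0 t by lra.
  have Hk := kappa_upper db hinit hs t0 w1.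
  rewrite ler_pdivlMr// -lerBlDl.
  have [k0|/ltW k0] := leP (kappa t * al - A) 0; first exact: le_trans (ltW i0).
  rewrite -[leRHS]mul1r ler_pdivlMr//; apply: le_trans Hk.
  by rewrite ler_wpM2l//; lra.
move=> kappa w hs.
have alE : `|deriv_n 1 psi 1| = al by rewrite -normrN gtr0_norm.
rewrite alE (_ : beta0^-1 - deriv_n 1 phi 1 - 1 = beta0^-1 - 1 + A); last by rewrite /A; ring.
apply/cvgrPdist_le => e e0.
(* After division by al S, half of e covers the error proportional to S and the other half the
   constant G, once S is large. *)
have e1 : 0 < e * al / 2 by rewrite divr_gt0// mulr_gt0.
have [G [T1 HG]] := kappa_integral_asymptotics db hinit q0 CU1 Hq hs (HCU _ _ hs) hbeta0 hbeta e1.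
near=> S.
have S0 : 0 < S by near: S; apply: nbhs_pinfty_gt; exact: num_real.
have S1 : T1 <= S by near: S; apply: nbhs_pinfty_ge; exact: num_real.
have S2 : G / (e * al / 2) <= S by near: S; apply: nbhs_pinfty_ge; exact: num_real.
have := HG S S1 S0; set K := Rintegral _ _ _ => HK.
rewrite ler_pdivrMr// in S2.
rewrite distrC.
have -> : S^-1 * K - (beta0^-1 - 1 + A) / al =
    (al * K - A * S - (beta0^-1 - 1) * S) / (al * S).
  by field; rewrite !gt_eqF.
have alS : 0 < al * S by rewrite mulr_gt0.
rewrite normrM normfV (gtr0_norm alS) ler_pdivrMr//.
apply: (le_trans HK); lra.
Unshelve. all: by end_near. Qed.
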